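(* For every integer $k\ge 2$, there is a combinatorial algorithm that, given a graph $G$ with $n$ vertices and $m$ edges that contains no cycle of length $2\ell+1$ for every $\ell\in\{2,3,\dots,k\}$, decides whether $G$ contains a triangle in time $O(m+n^{1+2/k})$.
   Context: A ''combinatorial'' algorithm does not use fast matrix multiplication. $k$ is a constant. *)

(* Defs.v *)
From mathcomp Require Import all_boot.

Set Implicit Arguments.
Unset Strict Implicit.
Unset Printing Implicit Defensive.

(** * Graphs *)

Record sgraph (n : nat) := SGraph {
  adj : rel 'I_n;
  adj_sym : symmetric adj;
  adj_irrefl : irreflexive adj }.

Definition edges n (G : sgraph n) : {set {set 'I_n}} :=
  [set [set x.1; x.2] | x : 'I_n * 'I_n & adj G x.1 x.2].

(* For L >= 3 this says that the cycle C_L is a (not necessarily induced)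
   subgraph of G; [cycle] also requires the closing edge. *)
Definition has_cycle n (G : sgraph n) (L : nat) : Prop :=
  exists c : seq 'I_n, [/\ size c = L, uniq c & cycle (adj G) c].

Definition has_triangle n (G : sgraph n) : Prop := has_cycle G 3.

(* Every edge occurs exactly once, with its end points in either order; the
   order of the list is arbitrary. *)
Definition edge_list n (G : sgraph n) (s : seq ('I_n * 'I_n)) : Prop :=
  perm_eq [seq [set x.1; x.2] | x <- s] (enum (edges G)).

(** * Combinatorial algorithms

  There is no accepted formal definition of "combinatorial".  The algorithms
  below are programs of a unit-cost random access machine whose only
  operations on words are copying, comparing, adding or subtracting 1, and use
  as an address.  There is no instruction for the sum, difference or product
  of two words, hence none for the ring operations on which fast matrix
  multiplication relies, and no oracle for matrix products.

  In t steps the largest word grows by at most t above the input words and the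
  constants of the program, so unit cost is realistic: a run that takes
  polynomial time only uses words of O(log n) bits.  A program mentions
  finitely many registers and arrays; the arrays can be interleaved in a single
  memory, so it runs on an ordinary word RAM with constant-factor overhead. *)

Record state := State {
  regs : nat -> nat;
  arrs : nat -> nat -> nat }.

Definition upd T (f : nat -> T) (x : nat) (v : T) : nat -> T :=
  fun y => if y == x then v else f y.

Definition set_reg (s : state) (x v : nat) : state :=
  State (upd (regs s) x v) (arrs s).

Definition set_arr (s : state) (a i v : nat) : state :=
  State (regs s) (upd (arrs s) a (upd (arrs s a) i v)).

(* [x], [y], [z] name registers, [a] names an array, [c] is a constant. *)
Inductive instr :=
  | IConst (x c : nat)    (* x := c *)
  | ICopy  (x y : nat)    (* x := y *)
  | ISucc  (x y : nat)    (* x := y + 1 *)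
  | IPred  (x y : nat)    (* x := max(y - 1, 0) *)
  | ILoad  (x a y : nat)  (* x := a[y] *)
  | IStore (a y z : nat). (* a[y] := z *)

Definition step (i : instr) (s : state) : state :=
  match i with
  | IConst x c => set_reg s x c
  | ICopy x y => set_reg s x (regs s y)
  | ISucc x y => set_reg s x (regs s y).+1
  | IPred x y => set_reg s x (regs s y).-1
  | ILoad x a y => set_reg s x (arrs s a (regs s y))
  | IStore a y z => set_arr s a (regs s y) (regs s z)
  end.

Inductive test :=
  | TEq (x y : nat)
  | TLt (x y : nat).

Definition holds (b : test) (s : state) : bool :=
  match b with
  | TEq x y => regs s x == regs s y
  | TLt x y => regs s x < regs s y
  end.

Inductive prog :=
  | PInstr (i : instr)
  | PSeq (p q : prog)
  | PIf (b : test) (p q : prog)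
  | PWhile (b : test) (p : prog).

(* [exec p s t s']: started in [s], the program [p] halts in [s'] after
   executing exactly [t] instructions and tests. *)
Inductive exec : prog -> state -> nat -> state -> Prop :=
  | EInstr i s : exec (PInstr i) s 1 (step i s)
  | ESeq p q s s1 s2 t1 t2 :
      exec p s t1 s1 -> exec q s1 t2 s2 -> exec (PSeq p q) s (t1 + t2) s2
  | EIfTrue b p q s s1 t :
      holds b s -> exec p s t s1 -> exec (PIf b p q) s t.+1 s1
  | EIfFalse b p q s s1 t :
      ~~ holds b s -> exec q s t s1 -> exec (PIf b p q) s t.+1 s1
  | EWhileTrue b p s s1 s2 t1 t2 :
      holds b s -> exec p s t1 s1 -> exec (PWhile b p) s1 t2 s2 ->
      exec (PWhile b p) s (t1 + t2).+1 s2
  | EWhileFalse b p s : ~~ holds b s -> exec (PWhile b p) s 1 s.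

Lemma exec_det p s t1 s1 t2 s2 :
  exec p s t1 s1 -> exec p s t2 s2 -> t1 = t2 /\ s1 = s2.
Proof.
move=> E; elim: E t2 s2 => {p s t1 s1}.
- by move=> i s t2 s2 E; inversion E.
- move=> p q s s1 s2 t1 t2 _ IHp _ IHq t s' E; inversion E; subst.
  match goal with H : exec p _ _ _ |- _ => case: (IHp _ _ H) => ? ?; subst end.
  by match goal with H : exec q _ _ _ |- _ => case: (IHq _ _ H) => ? ?; subst end.
- move=> b p q s s1 t hb _ IH t' s' E; inversion E; subst; last first.
    by match goal with H : is_true (~~ _) |- _ => rewrite hb in H end.
  by match goal with H : exec p _ _ _ |- _ => case: (IH _ _ H) => ? ?; subst end.
- move=> b p q s s1 t hb _ IH t' s' E; inversion E; subst.
    by match goal with H : is_true (holds _ _) |- _ => rewrite H in hb end.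
  by match goal with H : exec q _ _ _ |- _ => case: (IH _ _ H) => ? ?; subst end.
- move=> b p s s1 s2 t1 t2 hb _ IHp _ IHq t s' E; inversion E; subst; last first.
    by match goal with H : is_true (~~ _) |- _ => rewrite hb in H end.
  match goal with H : exec p _ _ _ |- _ => case: (IHp _ _ H) => ? ?; subst end.
  by match goal with H : exec (PWhile b p) _ _ _ |- _ =>
    case: (IHq _ _ H) => ? ?; subst end.
- move=> b p s hb t s' E; inversion E; subst => //.
  by match goal with H : is_true (holds _ _) |- _ => rewrite H in hb end.
Qed.

(* Registers 0 and 1 hold the numbers of vertices and of edges, and arrays 0
   and 1 the two end points of the successive edges; all else is 0. *)
Definition input n (s : seq ('I_n * 'I_n)) : state :=
  State (nth 0 [:: n; size s])
    (upd (upd (fun _ _ => 0)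
       0 (nth 0 [seq val x.1 | x <- s]))
       1 (nth 0 [seq val x.2 | x <- s])).

Definition accepts (s : state) : bool := regs s 0 != 0.

(* Main.v *)
(* Let D be the least positive integer with n <= D^k.  Every vertex has a list of
   out-neighbours, which only shrinks, and a list never loses the edges that lie
   in a triangle.  Vertices are searched breadth first.  If an edge joins two
   vertices of the same layer L_j, j <= k, the tree paths that end in them close
   an odd cycle of length at most 2k+1, which must be a triangle.  If w in L_j,
   j <= k, has two parents p and p', then pw is in no triangle pwz: the tree
   paths to p and p' and the path p z w p' would close a cycle of odd length
   between 5 and 2k+1.  So the arcs into w that are not in the tree can be
   deleted, and a search down to layer j costs |B_j| plus the number of deleted
   arcs, where B_j is the union of L_0, ..., L_j.

   After L_j has been scanned the search stops if
   |B_{j+1}| <= D + D^2 |B_{j-1}|; then no triangle meets B_{j-1}, so this set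
   is deleted, and each of its vertices pays O(D^2).  As long as the search does
   not stop, |B_{j+1}| > D^{j+1}, because |B_{j+1}| > D when j = 0 and
   |B_{j+1}| > D^2 |B_{j-1}| otherwise; hence it stops with j < k.  If it stops
   with j = 0 nothing is deleted, but the list of the root has length at most D.
   In the end all lists have length at most D, and the naive search of the paths
   x y z with z marked as a neighbour of x takes O(n D^2) steps.  Summing up,
   the time is O(m + n D^2) = O(m + n^(1+2/k)). *)
Require Import Defs.
From mathcomp Require Import all_boot all_order all_algebra.
From mathcomp Require Import reals exp.
From mathcomp Require Import zify lra.

Set Implicit Arguments.
Unset Strict Implicit.
Unset Printing Implicit Defensive.

(** * A program logic with time credits *)

Fixpoint wregs (p : prog) : seq nat :=
  match p with
  | PInstr (IConst x _) | PInstr (ICopy x _) | PInstr (ISucc x _)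
  | PInstr (IPred x _) | PInstr (ILoad x _ _) => [:: x]
  | PInstr (IStore _ _ _) => [::]
  | PSeq p q | PIf _ p q => wregs p ++ wregs q
  | PWhile _ p => wregs p
  end.

Fixpoint warrs (p : prog) : seq nat :=
  match p with
  | PInstr (IStore a _ _) => [:: a]
  | PInstr _ => [::]
  | PSeq p q | PIf _ p q => warrs p ++ warrs q
  | PWhile _ p => warrs p
  end.

(** The written registers and arrays are read off the syntax, so every triple brings the
    preservation of everything else for free, and postconditions only mention what changes. *)
Definition frame (p : prog) (s s' : state) : Prop :=
  (forall r, r \notin wregs p -> regs s' r = regs s r) /\
  (forall a, a \notin warrs p -> arrs s' a = arrs s a).

Lemma upd_same T (f : nat -> T) x v : upd f x v x = v.
Proof. by rewrite /upd eqxx. Qed.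

Lemma upd_other T (f : nat -> T) x v y : y != x -> upd f x v y = f y.
Proof. by rewrite /upd => /negbTE->. Qed.

Lemma exec_frame p s t s' : exec p s t s' -> frame p s s'.
Proof.
elim=> {p s t s'}.
- by case=> [x c|x y|x y|x y|x a y|a y z] s; split=> r //=;
    rewrite inE => ?; apply: upd_other.
- move=> p q s s1 s2 t1 t2 _ [r1 a1] _ [r2 a2]; split=> r /=;
    rewrite mem_cat negb_or => /andP[h1 h2].
    by rewrite r2 // r1.
  by rewrite a2 // a1.
- move=> b p q s s1 t _ _ [r1 a1]; split=> r /=;
    by rewrite mem_cat negb_or => /andP[h1 h2]; rewrite ?r1 ?a1.
- move=> b p q s s1 t _ _ [r1 a1]; split=> r /=;
    by rewrite mem_cat negb_or => /andP[h1 h2]; rewrite ?r1 ?a1.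
- move=> b p s s1 s2 t1 t2 _ _ [r1 a1] _ [r2 a2]; split=> r /= h.
    by rewrite r2 // r1.
  by rewrite a2 // a1.
- by move=> b p s _; split.
Qed.

(* Started in [s] with [c] time credits, [p] halts without exhausting them, and
   [Q] holds of the credits that are left and of the final state. *)
Definition tr (p : prog) (c : nat) (s : state) (Q : nat -> state -> Prop) :=
  exists t s', [/\ exec p s t s', t <= c & Q (c - t) s'].

Lemma tr_conseq p c s (Q Q' : nat -> state -> Prop) :
  tr p c s Q -> (forall c' s', frame p s s' -> Q c' s' -> Q' c' s') ->
  tr p c s Q'.
Proof.
move=> [t [s' [E le_t q]]] QQ'; exists t, s'; split=> //.
by apply: QQ' q; apply: exec_frame E.
Qed.

Lemma tr_instr i c s (Q : nat -> state -> Prop) :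
  Q c (step i s) -> tr (PInstr i) c.+1 s Q.
Proof. by move=> q; exists 1, (step i s); split; [exact: EInstr| |rewrite subn1]. Qed.

Lemma tr_seq p q c s (Q : nat -> state -> Prop) :
  tr p c s (fun c1 s1 => tr q c1 s1 Q) -> tr (PSeq p q) c s Q.
Proof.
move=> [t1 [s1 [E1 le1 [t2 [s2 [E2 le2 q2]]]]]].
exists (t1 + t2), s2; split; [exact: ESeq E1 E2|lia|by rewrite subnDA].
Qed.

Lemma tr_if b p q c s (Q : nat -> state -> Prop) :
  (if holds b s then tr p c s Q else tr q c s Q) -> tr (PIf b p q) c.+1 s Q.
Proof.
case hb: (holds b s) => -[t [s1 [E le q1]]]; exists t.+1, s1; split=> //;
  rewrite ?subSS //; first exact: EIfTrue.
by apply: EIfFalse; rewrite ?hb.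
Qed.

Lemma frame_refl p s : frame p s s.
Proof. by []. Qed.

(** The credits serve as the variant: each test of the guard costs one, so induction on the credits
    proves termination, provided that the invariant always leaves at least one. *)
Lemma tr_while b p (I : nat -> state -> Prop) c s (Q : nat -> state -> Prop) :
  I c s ->
  (forall c1 s1, frame p s s1 -> I c1 s1 -> 0 < c1 /\
     if holds b s1 then tr p c1.-1 s1 I else Q c1.-1 s1) ->
  tr (PWhile b p) c s Q.
Proof.
move=> Is step.
suff H m c1 s1 : c1 <= m -> frame p s s1 -> I c1 s1 -> tr (PWhile b p) c1 s1 Q.
  exact: H (leqnn c) (frame_refl p s) Is.
elim: m c1 s1 => [|m IHm] c1 s1 le_m fr I1.
  by have [c_gt0 _] := step _ _ fr I1; lia.
have [c_gt0] := step _ _ fr I1; case hb: (holds b s1); last first.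
  move=> q; exists 1, s1; split=> //; last by rewrite subn1.
  by apply: EWhileFalse; rewrite hb.
case=> t [s2 [E le_t I2]].
have [||t' [s3 [E' le_t' q]]] := IHm (c1.-1 - t) s2 _ _ I2.
- lia.
- have [r1 a1] := exec_frame E; case: fr => r0 a0.
  by split=> r h; rewrite ?r1 ?a1 // ?r0 ?a0.
- exists (t + t').+1, s3; split; [exact: EWhileTrue E'|lia|].
  by have -> : c1 - (t + t').+1 = c1.-1 - t - t' by lia.
Qed.

Lemma iter_succn m c : iter m S c = m + c.
Proof. by elim: m => //= m ->. Qed.

(** Writing the credits as explicit successors lets [tr_instr] and [tr_if] consume them by
    unification. *)
Lemma credit_split m c : m <= c -> exists c', c = iter m S c'.
Proof. by move=> le; exists (c - m); rewrite iter_succn subnKC. Qed.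

Lemma sub_in_count (T : eqType) (a b : pred T) (s : seq T) :
  {in s, forall x, a x -> b x} -> count a s <= count b s.
Proof.
elim: s => //= x s IHs ab; apply: leq_add.
  by case ax: (a x) => //; rewrite ab ?mem_head.
by apply: IHs => y ys; apply: ab; rewrite inE ys orbT.
Qed.

(** * Breadth-first search and short odd cycles *)

Section Search.

Variables (E : rel nat) (n k : nat).
Hypothesis E_sym : symmetric E.
Hypothesis E_irr : irreflexive E.
Hypothesis E_lt : forall x y, E x y -> x < n.
Hypothesis E_odd : forall l c, 2 <= l <= k -> size c = 2 * l + 1 -> uniq c ->
  ~~ cycle E c.

Definition triangle x y z := [&& E x y, E y z & E z x].

Lemma triangle_rot x y z : triangle x y z -> triangle y z x.
Proof. by case/and3P=> xy yz zx; rewrite /triangle xy yz zx. Qed.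

Lemma triangle_flip x y z : triangle x y z -> triangle y x z.
Proof.
case/and3P=> xy yz zx.
by rewrite /triangle (E_sym y x) (E_sym x z) (E_sym z y) xy yz zx.
Qed.

(* The tree of parents [par] has its root on the layer [g0], and [lay] is the
   depth shifted by [g0]; vertices with [lay < g0] are outside of the tree. *)
Definition bfs_tree (lay par : nat -> nat) (g0 root : nat) :=
  forall x, g0 <= lay x -> x = root /\ lay x = g0 \/
    [/\ g0 <= lay (par x), lay x = (lay (par x)).+1 & E (par x) x].

(** Climb from both ends to their parents until the two branches meet. Inner vertices lie on smaller
    layers than the ends, which keeps the path simple, and the number [2 * l] of edges is even
    because both ends climb equally often. *)
Lemma tree_path lay par g0 root j a b :
  bfs_tree lay par g0 root -> lay a = g0 + j -> lay b = g0 + j -> a != b ->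
  exists l c, [/\ 0 < l <= j, size c = 2 * l - 1, path E a (rcons c b),
    uniq (a :: rcons c b) & forall y, y \in c -> g0 <= lay y < g0 + j].
Proof.
move=> tree; elim: j a b => [|j IHj] a b laya layb neq_ab.
  case: (tree a); [lia| |by move=> []; lia] => -[eqa _].
  case: (tree b); [lia| |by move=> []; lia] => -[eqb _].
  by rewrite eqa eqb eqxx in neq_ab.
case: (tree a); [lia|by move=> []; lia|] => -[ga la Ea].
case: (tree b); [lia|by move=> []; lia|] => -[gb lb Eb].
have [eq_par|neq_par] := eqVneq (par a) (par b).
  exists 1, [:: par a]; split=> //=.
  - by rewrite E_sym Ea eq_par Eb.
  - rewrite !inE negb_or neq_ab !andbT; apply/andP; split=> //;
      by apply/eqP=> /(congr1 lay); lia.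
  - by move=> y; rewrite inE => /eqP->; lia.
have [||l [c [hl sz_c pth un layc]]] := IHj (par a) (par b) _ _ neq_par; try lia.
exists l.+1, (par a :: rcons c (par b)); split.
- lia.
- by rewrite /= size_rcons; lia.
- by rewrite /= rcons_path pth E_sym Ea last_rcons Eb.
- rewrite cons_uniq rcons_uniq; set c' := par a :: _ in un *.
  have layc' y : y \in c' -> lay y <= g0 + j.
    rewrite inE mem_rcons inE => /orP[/eqP->|/orP[/eqP->|/layc]]; lia.
  rewrite un andbT; apply/andP; split.
    rewrite mem_rcons inE negb_or neq_ab /=; apply/negP=> /layc'; lia.
  by apply/negP=> /layc'; lia.
- move=> y; rewrite inE mem_rcons inE => /orP[/eqP->|/orP[/eqP->|/layc]]; lia.
Qed.

(** The edge closes the even tree path to a cycle of length [2 * l + 1] with [l <= k]. This is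
    excluded for [l >= 2], and for [l = 1] the cycle is a triangle. *)
Lemma same_layer_triangle lay par g0 root a b :
  bfs_tree lay par g0 root -> lay a = lay b -> g0 <= lay a <= g0 + k ->
  E a b -> exists x y z, triangle x y z.
Proof.
move=> tree eq_lay hlay Eab.
have neq_ab : a != b by apply/eqP=> e; rewrite e E_irr in Eab.
have [||l [c [hl sz_c pth un _]]] := @tree_path lay par g0 root (lay a - g0) a b
  tree _ _ neq_ab; try lia.
have cyc : cycle E (a :: rcons c b).
  by rewrite /= rcons_path pth last_rcons E_sym.
have sz : size (a :: rcons c b) = 2 * l + 1 by rewrite /= size_rcons; lia.
have [l2|l1] := leqP 2 l.
  by case/negP: (@E_odd l (a :: rcons c b) ltac:(lia) sz un).
case: c sz_c cyc {sz pth un} => [|x [|? ?]] /= sz cyc; try lia.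
by exists a, x, b; move: cyc; rewrite /triangle andbT.
Qed.

(** A triangle would close the tree path from [u] to [v] through [w] and [z] to a cycle of length
    [2 * l.+1 + 1], between 5 and [2 * k + 1]. Inner vertices of the path are on smaller layers than
    [u], so the condition on [lay z] keeps [z] off it. *)
Lemma no_triangle_below lay par g0 root u v w z :
  bfs_tree lay par g0 root -> lay u = lay v -> g0 <= lay u < g0 + k ->
  u != v -> E v w -> lay w = (lay u).+1 ->
  z != v -> (g0 <= lay z -> lay u <= lay z) -> ~~ triangle u w z.
Proof.
move=> tree eq_lay hlay neq_uv Evw layw neq_zv layz.
apply/negP=> /and3P[Euw Ewz Ezu].
have [||l [c [hl sz_c pth un layc]]] := @tree_path lay par g0 root (lay u - g0) u v
  tree _ _ neq_uv; try lia.
have neq_zu : z != u by apply/eqP=> e; rewrite e E_irr in Ezu.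
have neq_zw : z != w by apply/eqP=> e; rewrite e E_irr in Ewz.
have cyc : cycle E [:: w, z, u & rcons c v].
  by rewrite /= rcons_path pth last_rcons Ewz Ezu Evw.
have sz : size [:: w, z, u & rcons c v] = 2 * l.+1 + 1.
  by rewrite /= size_rcons; lia.
suff un' : uniq [:: w, z, u & rcons c v].
  by case/negP: (@E_odd l.+1 _ ltac:(lia) sz un').
rewrite 2!cons_uniq un andbT inE (eq_sym w z) (negbTE neq_zw) /=.
rewrite !inE !mem_rcons !inE (negbTE neq_zu) (negbTE neq_zv) /= !negb_or.
rewrite -!andbA; apply/and4P; split.
- by apply/eqP=> e; rewrite e in layw; lia.
- by apply/eqP=> e; rewrite e in layw; lia.
- by apply/negP=> /layc; lia.
- apply/negP=> /layc; lia.
Qed.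

(* An arc is worth 2 while its target is alive and 1 afterwards.  Looking at an
   arc consumes one unit, except for arcs of the tree, which the discovered
   vertex pays for: an arc into a lower layer is worth 1 from then on, as if its
   target were already dead, and a rejected arc is worth nothing. *)
Definition weight (todo done : nat -> seq nat) (dead lay : nat -> nat) x :=
  size (todo x) + count (fun y => dead y == 0) (todo x)
  + size (done x) + count (fun y => lay x < lay y) (done x).

Definition potential (lst : nat -> seq nat) (dead : nat -> nat) x :=
  size (lst x) + count (fun y => dead y == 0) (lst x).

(** Triples are ordered, so both arcs of every edge of a triangle stay listed. Once a triangle is
    known to exist ([fnd <> 0]), arcs may be lost freely. *)
Record sound (lst : nat -> seq nat) (dead : nat -> nat) (fnd : nat) : Prop :=
  Sound {
  sound_edge : forall x y, y \in lst x -> E x y;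
  sound_dead : forall x, dead x <> 0 -> lst x = [::];
  sound_tri : fnd = 0 -> forall x y z, triangle x y z ->
    y \in lst x /\ dead x = 0;
  sound_fnd : fnd <> 0 -> exists x y z, triangle x y z }.

(* The vertex [u] is being scanned: the arcs in [todo u] are still to be looked
   at, and those in [done u] have been looked at and kept.  The arcs are
   directed: keeping [x -> y] does not imply keeping [y -> x]. *)
Record searching (todo done : nat -> seq nat) (dead lay par : nat -> nat)
    (fnd g0 g root u : nat) : Prop := Searching {
  srch_sound : sound (fun x => todo x ++ done x) dead fnd;
  srch_tree : bfs_tree lay par g0 root;
  srch_par : forall x, g0 < lay x -> x \in done (par x);
  srch_lay : forall x, lay x <= g.+1;
  srch_done : forall x y, y \in done x ->
    [/\ g0 <= lay x <= g, g0 <= lay y, lay y <= (lay x).+1 & lay y <> lay x];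
  srch_todo : forall x, g0 <= lay x < g -> todo x = [::];
  srch_one : forall x, x <> u -> todo x = [::] \/ done x = [::];
  srch_alive : forall x, g0 <= lay x -> dead x = 0 /\ x < n;
  srch_g : g0 <= g < g0 + k }.

Lemma searching_start lst dead lay fnd g0 root u :
  0 < k -> sound lst dead fnd -> (forall x, lay x < g0) -> dead root = 0 ->
  root < n ->
  searching lst (fun=> [::]) dead (upd lay root g0) id fnd g0 g0 root u.
Proof.
move=> k_gt0 [edge dd tri fd] layP alive ltn; split=> //=; rewrite ?/upd.
- split=> // [x y|x|f0 x y z t]; rewrite cats0; [exact: edge|exact: dd|exact: tri t].
- by move=> x; rewrite /upd; case: eqP => [->|_]; [left|have := layP x; lia].
- by move=> x; case: eqP => _; have := layP x; lia.
- by move=> x; case: eqP => _; have := layP x; lia.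
- by move=> x; case: eqP => _; have := layP x; lia.
- by right.
- by move=> x; case: eqP => [->|] //; have := layP x; lia.
- lia.
Qed.

Definition vsum (f : nat -> nat) := \sum_(x < n) f x.

Lemma leq_vsum (f f' : nat -> nat) :
  (forall x, f' x <= f x) -> vsum f' <= vsum f.
Proof. by move=> le; apply: leq_sum => x _. Qed.

Lemma vsum_at (f f' : nat -> nat) u : u < n ->
  (forall x, x <> u -> f' x = f x) -> vsum f' + f u = vsum f + f' u.
Proof.
move=> lt_un other; rewrite /vsum; have sumE := bigD1 (Ordinal lt_un).
rewrite sumE // [X in _ = X + _]sumE //=.
have -> : \sum_(x < n | x != Ordinal lt_un) f' x =
    \sum_(x < n | x != Ordinal lt_un) f x.
  by apply: eq_bigr => x ne; apply: other => e; rewrite -val_eqE /= e eqxx in ne.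
by move: (bigop.body _ _ _) => R; lia.
Qed.

Lemma ltn_vsum (f f' : nat -> nat) u : u < n ->
  (forall x, x <> u -> f' x = f x) -> f' u < f u -> vsum f' < vsum f.
Proof. by move=> lt_un other lt_u; have := vsum_at lt_un other; lia. Qed.

Section Arc.

Variables (todo done todo' done' : nat -> seq nat) (dead lay par : nat -> nat).
Variables (fnd g0 g root u y : nat) (rem : seq nat).
Hypothesis S : searching todo done dead lay par fnd g0 g root u.
Hypothesis lay_u : lay u = g.
Hypothesis todo_u : todo u = y :: rem.
Hypothesis todo_other : forall x, x <> u -> todo' x = todo x.
Hypothesis done_other : forall x, x <> u -> done' x = done x.
Hypothesis todo_u' : todo' u = rem.

Lemma alive_u : dead u = 0 /\ u < n.
Proof. by apply: (srch_alive S); rewrite lay_u; have := srch_g S; lia. Qed.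

Lemma arc_edge : E u y.
Proof. by apply: (sound_edge (srch_sound S)); rewrite todo_u mem_head. Qed.

(** Besides arcs outside of all triangles, a second copy of a kept arc may go: the invariants allow
    a list to name a target twice. *)
Lemma searching_drop fnd' : done' u = done u ->
  (fnd' = 0 -> fnd = 0 /\ ((forall z, ~~ triangle u y z) \/ y \in done u)) ->
  (fnd' <> 0 -> exists x y z, triangle x y z) ->
  searching todo' done' dead lay par fnd' g0 g root u.
Proof.
move=> done_u f0 f1; case: S => -[edge dd tri fd] tree hpar hlay hdone htodo one al hg.
have doneE x : done' x = done x by case: (eqVneq x u) => [->//|/eqP/done_other].
split=> //.
- split=> //.
  + move=> x z; rewrite doneE => h; apply: edge; move: h; case: (eqVneq x u) => [->|/eqP ne].
      by rewrite todo_u todo_u' inE => ->; rewrite orbT.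
    by rewrite todo_other.
  + move=> x /[dup] h /dd; rewrite doneE; case: (eqVneq x u) => [eqx|/eqP ne].
      by case: h; rewrite eqx; have [] := alive_u.
    by rewrite todo_other.
  + move=> /f0[/tri {}tri h] x z v t; have [hz hx] := tri _ _ _ t; split=> //.
    rewrite doneE; move: hz t; case: (eqVneq x u) => [->|/eqP ne]; last by rewrite todo_other.
    rewrite todo_u todo_u' inE; case: eqP => [->|//] _ t.
    case: h => [/(_ v)/negP//|]; by rewrite mem_cat => ->; rewrite orbT.
- by move=> x hx; rewrite doneE; apply: hpar.
- by move=> x z; rewrite doneE; apply: hdone.
- move=> x hx; rewrite todo_other; first exact: htodo.
  by move=> e; rewrite e in hx; lia.
- by move=> x ne; rewrite doneE todo_other //; apply: one.
Qed.

Lemma searching_low : g0 <= lay y < g -> done' u = y :: done u ->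
  searching todo' done' dead lay par fnd g0 g root u.
Proof.
move=> hy done_u; case: S => -[edge dd tri fd] tree hpar hlay hdone htodo one al hg.
have memE x z : (z \in todo' x ++ done' x) = (z \in todo x ++ done x).
  case: (eqVneq x u) => [->|/eqP ne]; last by rewrite todo_other ?done_other.
  by rewrite todo_u todo_u' done_u !mem_cat !inE orbCA orbA.
have doneS x z : z \in done x -> z \in done' x.
  case: (eqVneq x u) => [->|/eqP ne]; last by rewrite done_other.
  by rewrite done_u inE => ->; rewrite orbT.
split=> //.
- split=> //.
  + by move=> x z; rewrite memE; apply: edge.
  + move=> x /[dup] h /dd; case: (eqVneq x u) => [eqx|/eqP ne].
      by case: h; rewrite eqx; have [] := alive_u.
    by rewrite todo_other ?done_other.
  + by move=> f0 x z v; rewrite memE; apply: tri.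
- by move=> x /hpar/doneS.
- move=> x z; case: (eqVneq x u) => [->|/eqP ne]; last by rewrite done_other //; apply: hdone.
  by rewrite done_u inE => /orP[/eqP->|/hdone//]; split; lia.
- move=> x hx; rewrite todo_other; first exact: htodo.
  by move=> e; rewrite e in hx; lia.
- by move=> x ne; rewrite done_other ?todo_other //; apply: one.
Qed.

Lemma searching_new : lay y < g0 -> dead y = 0 -> done' u = y :: done u ->
  searching todo' done' dead (upd lay y g.+1) (upd par y u) fnd g0 g root u.
Proof.
move=> hy al_y done_u; have Euy := arc_edge.
case: S => -[edge dd tri fd] tree hpar hlay hdone htodo one al hg.
have neq_uy : u != y by apply/eqP=> e; rewrite -e in hy; lia.
have memE x z : (z \in todo' x ++ done' x) = (z \in todo x ++ done x).
  case: (eqVneq x u) => [->|/eqP ne]; last by rewrite todo_other ?done_other.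
  by rewrite todo_u todo_u' done_u !mem_cat !inE orbCA orbA.
have doneS x z : z \in done x -> z \in done' x.
  case: (eqVneq x u) => [->|/eqP ne]; last by rewrite done_other.
  by rewrite done_u inE => ->; rewrite orbT.
have neq_y x : g0 <= lay x -> x != y by move=> h; apply/eqP=> e; rewrite e in h; lia.
split=> //.
- split=> //.
  + by move=> x z; rewrite memE; apply: edge.
  + move=> x /[dup] h /dd; case: (eqVneq x u) => [eqx|/eqP ne].
      by case: h; rewrite eqx; have [] := alive_u.
    by rewrite todo_other ?done_other.
  + by move=> f0 x z v; rewrite memE; apply: tri.
- move=> x; case: (eqVneq x y) => [->|ne].
    by right; rewrite !upd_same upd_other // lay_u; split=> //; lia.
  rewrite (upd_other lay _ ne) (upd_other par _ ne) => hx.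
  case: (tree _ hx) => [[-> ->]|[hp lp Ep]]; [by left|right].
  by rewrite upd_other ?neq_y.
- move=> x; rewrite /upd; case: eqP => [->|/eqP ne] hx; last exact/doneS/hpar.
  by rewrite done_u mem_head.
- by move=> x; rewrite /upd; case: eqP.
- have old x z : z \in done x -> [/\ g0 <= upd lay y g.+1 x <= g,
      g0 <= upd lay y g.+1 z, upd lay y g.+1 z <= (upd lay y g.+1 x).+1 &
      upd lay y g.+1 z <> upd lay y g.+1 x].
    move=> /hdone[a1 a2 a3 a4].
    by rewrite !upd_other ?neq_y //; lia.
  move=> x z; case: (eqVneq x u) => [->|/eqP ne]; last by rewrite done_other //; apply: old.
  rewrite done_u inE => /orP[/eqP->|/old//]; rewrite upd_same upd_other // lay_u.
  by split; lia.
- move=> x; rewrite /upd; case: eqP => [_|_] hx; first lia.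
  rewrite todo_other; first exact: htodo.
  by move=> e; rewrite e in hx; lia.
- by move=> x ne; rewrite done_other ?todo_other //; apply: one.
- move=> x; rewrite /upd; case: eqP => [->|_] hx; last exact: al.
  by split=> //; rewrite E_sym in Euy; apply: E_lt Euy.
Qed.

(** If [u] is not the parent of [y], apply [no_triangle_below] with [v] the parent. The parent has
    been scanned, and its kept arcs leave its layer, so it is not adjacent to [u] in a triangle.
    Vertices of smaller layers have been scanned too, and their kept arcs descend by at most one
    layer, so they do not reach [y]. *)
Lemma no_triangle_nontree : fnd = 0 -> lay y = g.+1 ->
  (forall z, ~~ triangle u y z) \/ y \in done u.
Proof.
move=> f0 layy; case: S => -[edge dd tri fd] tree hpar hlay hdone htodo one al hg.
have ydone := hpar y ltac:(lia).
case: (eqVneq u (par y)) => [->|neq]; [by right|left=> z].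
case: (tree y); [lia|by move=> []; lia|] => -[hp lp Ep].
have todo_p : todo (par y) = [::].
  case: (one (par y)) => // [e|e]; first by rewrite e eqxx in neq.
  by rewrite e in ydone.
apply/negP=> t; suff: ~~ triangle u y z by rewrite t.
apply: (@no_triangle_below lay par g0 root u (par y) y z) => //; try lia.
- apply/eqP=> ez; have [] := tri f0 _ _ _ (triangle_rot (triangle_rot t)).
  by rewrite ez todo_p => /hdone[_ _ _]; lia.
- move=> hz; rewrite leqNgt; apply/negP=> lz.
  have [] := tri f0 _ _ _ (triangle_flip (triangle_rot t)).
  rewrite (htodo z) /=; last lia.
  by move=> /hdone[_ _ ]; lia.
Qed.

Lemma weight_drop : done' u = done u ->
  vsum (weight todo' done' dead lay)
    < vsum (weight todo done dead lay).
Proof.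
move=> done_u; have [_ lt_un] := alive_u; apply: ltn_vsum lt_un _ _ => [x ne|].
  by rewrite /weight todo_other ?done_other.
by rewrite /weight done_u todo_u todo_u' /=; lia.
Qed.

Lemma weight_low : lay y < g -> dead y = 0 -> done' u = y :: done u ->
  vsum (weight todo' done' dead lay)
    < vsum (weight todo done dead lay).
Proof.
move=> lt_y al_y done_u; have [_ lt_un] := alive_u.
apply: ltn_vsum lt_un _ _ => [x ne|].
  by rewrite /weight todo_other ?done_other.
rewrite /weight done_u todo_u todo_u' /= al_y lay_u eqxx.
have -> : (g < lay y) = false by lia.
lia.
Qed.

(** The arc is worth 2 before, for its alive target, and 2 afterwards, for a target on a deeper
    layer. The step is charged to the debt of the new vertex instead. *)
Lemma weight_new : lay y < g0 -> dead y = 0 -> done' u = y :: done u ->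
  vsum (weight todo' done' dead (upd lay y g.+1))
    = vsum (weight todo done dead lay).
Proof.
move=> hy al_y done_u; apply: eq_bigr => -[x /= _] _.
(* Kept arcs only join visited vertices, so the new stamp of [y] does not affect them. *)
have countE : count (fun z => upd lay y g.+1 x < upd lay y g.+1 z) (done x) =
    count (fun z => lay x < lay z) (done x).
  apply: eq_in_count => z /(srch_done S)[h1 h2 _ _].
  by rewrite !upd_other //; apply/eqP=> e; rewrite e in h1 h2; lia.
have hg := srch_g S.
rewrite /weight; case: (eqVneq x u) => [eqx|/eqP ne]; last first.
  by rewrite todo_other ?done_other ?countE.
rewrite eqx in countE *; rewrite todo_u' todo_u done_u /= countE al_y eqxx.
rewrite upd_same upd_other ?lay_u ?ltnSn; first lia.
by apply/eqP=> e; rewrite -e in hy; lia.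
Qed.

End Arc.

Lemma searching_next todo done dead lay par fnd g0 g root u u' :
  searching todo done dead lay par fnd g0 g root u ->
  (forall x, g0 <= lay x <= g -> todo x = [::]) -> g.+1 < g0 + k ->
  searching todo done dead lay par fnd g0 g.+1 root u'.
Proof.
case=> snd tree hpar hlay hdone htodo one al hg all_done lt_g; split=> //.
- by move=> x; apply: leqW.
- by move=> x y /hdone[? ? ? ?]; split=> //; lia.
- move=> x _; case dx: (done x) => [|y s]; [by right|left].
  by apply: all_done; case: (hdone x y) => //; rewrite dx mem_head.
- lia.
Qed.

Lemma searching_current todo done dead lay par fnd g0 g root u u' :
  searching todo done dead lay par fnd g0 g root u -> 
  (todo u = [::] \/ done u = [::]) ->
  searching todo done dead lay par fnd g0 g root u'.
Proof.
case=> snd tree hpar hlay hdone htodo one al hg hu; split=> // x _.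
by case: (eqVneq x u) => [->|/eqP/one].
Qed.

(** A triangle with a vertex on a layer before [g] would have all its vertices on scanned layers.
    Kept arcs join adjacent layers, and three integers cannot pairwise differ by exactly 1. *)
Lemma sound_kill todo done dead lay par fnd g0 g root u lst' dead' :
  searching todo done dead lay par fnd g0 g root u ->
  (forall x, g0 <= lay x <= g -> todo x = [::]) ->
  (forall x, lst' x = if g0 <= lay x < g then [::] else todo x ++ done x) ->
  (forall x, dead' x = if g0 <= lay x < g then 1 else dead x) ->
  sound lst' dead' fnd.
Proof.
case=> -[edge dd tri fd] tree hpar hlay hdone htodo one al hg all_done lstE deadE.
split=> //.
- by move=> x y; rewrite lstE; case: ifP => // _; apply: edge.
- by move=> x; rewrite deadE lstE; case: ifP => // _; apply: dd.
- move=> f0 x y z t; rewrite lstE deadE; case: ifP => [hx|_]; last exact: tri t.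
  have step a b c : triangle a b c -> g0 <= lay a <= g ->
      [/\ g0 <= lay b, lay b <= (lay a).+1 & lay b <> lay a].
    move=> t' ha; have [] := tri f0 _ _ _ t'; rewrite all_done //= => /hdone[_ ? ? ?] _.
    by [].
  have [y1 y2 y3] := step _ _ _ t ltac:(lia).
  have t' := triangle_flip (triangle_rot (triangle_rot t)).
  have [z1 z2 z3] := step _ _ _ t' ltac:(lia).
  have [_ z4 z5] := step _ _ _ (triangle_rot t) ltac:(lia).
  have [_ y4 y5] := step _ _ _ (triangle_rot t') ltac:(lia).
  have [_ x4 x5] := step _ _ _ (triangle_flip t) ltac:(lia).
  have [_ x6 x7] := step _ _ _ (triangle_flip t') ltac:(lia).
  lia.
Qed.

(** This closes the accounts of a search: a kept arc of a vertex that is not deleted starts on layer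
    [g], so if its target is alive, it lies on layer [g.+1] and is already counted by [weight]. *)
Lemma potential_kill todo done dead lay par fnd g0 g root u lst' dead' x :
  searching todo done dead lay par fnd g0 g root u ->
  (forall x, lst' x = if g0 <= lay x < g then [::] else todo x ++ done x) ->
  (forall x, dead' x = if g0 <= lay x < g then 1 else dead x) ->
  potential lst' dead' x <= weight todo done dead lay x.
Proof.
case=> -[edge dd tri fd] tree hpar hlay hdone htodo one al hg lstE deadE.
rewrite /potential /weight lstE; case: ifP => // nB.
rewrite size_cat count_cat.
have le1 : count (fun y => dead' y == 0) (todo x) <= count (fun y => dead y == 0) (todo x).
  by apply: sub_count => y /=; rewrite deadE; case: ifP.
suff le2 : count (fun y => dead' y == 0) (done x) <= count (fun y => lay x < lay y) (done x).
  by lia.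
apply: sub_in_count => y /hdone[h1 h2 h3 h4] /=; rewrite deadE.
by case: ifP => //; lia.
Qed.

End Search.

(** * Adjacency lists *)

(** Nodes are positive and 0 is the null pointer, in agreement with arrays that are initially 0. *)
Fixpoint chain (nx : nat -> nat) (h : nat) (l : seq nat) : Prop :=
  if l is e :: l' then [/\ h = e, 0 < e & chain nx (nx e) l'] else h = 0.

Lemma chain_upd nx e v h l : e \notin l -> chain nx h l -> chain (upd nx e v) h l.
Proof.
elim: l h => //= e' l IHl h; rewrite inE negb_or => /andP[ne nl] [-> gt ch].
by split=> //; rewrite upd_other 1?eq_sym //; apply: IHl.
Qed.

Lemma chain_nil nx l : chain nx 0 l -> l = [::].
Proof. by case: l => //= e l [<-]. Qed.

Lemma chain_cons nx h l : 0 < h -> chain nx h l ->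
  exists l', l = h :: l' /\ chain nx (nx h) l'.
Proof. by case: l => [|e l] /= h_gt0; [lia|case=> <- _ ch; exists l]. Qed.

(* The list of [x] consists of nodes [e] with [src e = x], so that the lists of
   distinct vertices share no node. *)
Definition owned (src : nat -> nat) (nd : nat -> seq nat) :=
  forall x, uniq (nd x) /\ (forall e, e \in nd x -> src e = x).

Definition lists (hd nx : nat -> nat) (nd : nat -> seq nat) :=
  forall x, chain nx (hd x) (nd x).

(* While the list of [u] is scanned, [x0] points to its unscanned part [tn u],
   and the head of [u] to the nodes [dn u] that have been kept. *)
Definition open_lists (hd nx : nat -> nat) (tn dn : nat -> seq nat) (u x0 : nat) :=
  [/\ forall x, x <> u -> chain nx (hd x) (tn x ++ dn x),
      chain nx (hd u) (dn u) & chain nx x0 (tn u)].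

Lemma open_lists_start hd nx tn dn u :
  lists hd nx (fun x => tn x ++ dn x) -> dn u = [::] ->
  open_lists (upd hd u 0) nx tn dn u (hd u).
Proof.
move=> ch du; split=> [x /eqP ne||]; first by rewrite upd_other.
  by rewrite upd_same du.
by have := ch u; rewrite /= du cats0.
Qed.

Lemma open_lists_end hd nx tn dn u :
  open_lists hd nx tn dn u 0 -> lists hd nx (fun x => tn x ++ dn x) /\ tn u = [::].
Proof.
move=> [ch chu ch0]; have tu := chain_nil ch0; split=> // x.
by case: (eqVneq x u) => [->|/eqP /ch//]; rewrite tu.
Qed.

Lemma owned_drop src tn dn tn' u e r :
  tn u = e :: r -> (forall x, x <> u -> tn' x = tn x) -> tn' u = r ->
  owned src (fun x => tn x ++ dn x) -> owned src (fun x => tn' x ++ dn x).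
Proof.
move=> tu to tu' ow x; have := ow x; case: (eqVneq x u) => [->|/eqP ne]; last by rewrite to.
rewrite tu tu' /= => -[/andP[_ un] os]; split=> // e' h; apply: os.
by rewrite inE h orbT.
Qed.

Lemma owned_keep src tn dn tn' dn' u e r :
  tn u = e :: r -> (forall x, x <> u -> tn' x = tn x) -> tn' u = r ->
  (forall x, x <> u -> dn' x = dn x) -> dn' u = e :: dn u ->
  owned src (fun x => tn x ++ dn x) -> owned src (fun x => tn' x ++ dn' x).
Proof.
move=> tu to tu' do_ du' ow x; have := ow x.
case: (eqVneq x u) => [->|/eqP ne]; last by rewrite to ?do_.
have pE : perm_eq (r ++ e :: dn u) (e :: r ++ dn u) by rewrite perm_catC /= perm_cons perm_catC.
rewrite tu tu' du' => -[un os]; split; first by rewrite (perm_uniq pE).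
by move=> e'; rewrite (perm_mem pE); apply: os.
Qed.

Lemma open_lists_drop hd nx tn dn tn' u e r :
  tn u = e :: r -> (forall x, x <> u -> tn' x = tn x) -> tn' u = r ->
  open_lists hd nx tn dn u e -> open_lists hd nx tn' dn u (nx e).
Proof.
move=> tu to tu' [ch chu ch0]; split=> // [x ne|]; first by rewrite to //; apply: ch.
by move: ch0; rewrite tu tu' /= => -[].
Qed.

Lemma open_lists_keep src hd nx tn dn tn' dn' u e r :
  owned src (fun x => tn x ++ dn x) ->
  tn u = e :: r -> (forall x, x <> u -> tn' x = tn x) -> tn' u = r ->
  (forall x, x <> u -> dn' x = dn x) -> dn' u = e :: dn u ->
  open_lists hd nx tn dn u e ->
  open_lists (upd hd u e) (upd nx e (hd u)) tn' dn' u (nx e).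
Proof.
move=> ow tu to tu' do_ du' [ch chu ch0].
have [+ os] := ow u; rewrite tu /= mem_cat negb_or -andbA => /and3P[ner ned un].
split=> [x ne||].
- rewrite upd_other; last exact/eqP.
  rewrite to // do_ //; apply: chain_upd; last exact: ch.
  apply/negP=> /(proj2 (ow x)) => sx; apply: ne; rewrite -sx.
  by apply: os; rewrite tu mem_head.
- move: ch0; rewrite tu upd_same du' /= => -[_ gt _]; split=> //.
  by rewrite upd_same; apply: chain_upd.
- by rewrite tu'; apply: chain_upd => //; move: ch0; rewrite tu /= => -[].
Qed.

(** * Scanning a layer *)

(* [rG] is the stamp of the layer being scanned and [rG0] that of the root;
   array [aLay] keeps the stamps of earlier searches, so that [w] is unvisited
   iff [aLay[w] < rG0].  [rB0] and [rB1] delimit the layer in the queue, [rQt]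
   is the end of the queue, and [rBud = rD + rQ * rCp] is the bound on [rQt] at
   which the search stops. *)
Local Notation rN := 0 (only parsing).
Local Notation rM := 1 (only parsing).
Local Notation rZ := 2 (only parsing).
Local Notation rOne := 3 (only parsing).
Local Notation rD := 4 (only parsing).
Local Notation rQ := 5 (only parsing).
Local Notation rV := 6 (only parsing).
Local Notation rG0 := 7 (only parsing).
Local Notation rG := 8 (only parsing).
Local Notation rG1 := 9 (only parsing).
Local Notation rB0 := 10 (only parsing).
Local Notation rB1 := 11 (only parsing).
Local Notation rPos := 12 (only parsing).
Local Notation rQt := 13 (only parsing).
Local Notation rCp := 14 (only parsing).
Local Notation rBud := 15 (only parsing).
Local Notation rF := 16 (only parsing).
Local Notation rU := 17 (only parsing).
Local Notation rX := 18 (only parsing).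
Local Notation rY := 19 (only parsing).
Local Notation rW := 20 (only parsing).
Local Notation rL := 21 (only parsing).

Local Notation aHead := 2 (only parsing).
Local Notation aNext := 3 (only parsing).
Local Notation aTo := 4 (only parsing).
Local Notation aDead := 5 (only parsing).
Local Notation aLay := 6 (only parsing).
Local Notation aQue := 7 (only parsing).
Local Notation aMark := 8 (only parsing).

Local Notation "p ;; q" := (PSeq p q) (at level 60, right associativity).
Local Coercion PInstr : instr >-> prog.

Definition skip : prog := ICopy rL rL.

Definition keep_arc : prog :=
  ILoad rL aHead rU ;; IStore aNext rX rL ;; IStore aHead rU rX.

Definition scan_arc : prog :=
  ILoad rW aTo rX ;; ILoad rY aNext rX ;; ILoad rL aDead rW ;;
  PIf (TEq rL rZ)
    (ILoad rL aLay rW ;;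
     PIf (TLt rL rG0)
       (IStore aLay rW rG1 ;; IStore aQue rQt rW ;; ISucc rQt rQt ;; keep_arc)
     (PIf (TLt rL rG) keep_arc
     (PIf (TEq rL rG) (ICopy rF rOne) skip)))
    skip ;;
  ICopy rX rY.

Definition scan_list : prog :=
  ILoad rX aHead rU ;; IStore aHead rU rZ ;; PWhile (TLt rZ rX) scan_arc.

Definition scan_layer : prog :=
  ICopy rPos rB0 ;;
  PWhile (TLt rPos rB1) (ILoad rU aQue rPos ;; scan_list ;; ISucc rPos rPos).

Ltac is_num x := match x with O => idtac | S ?y => is_num y end.

Ltac upd_simp := repeat match goal with |- context [@upd ?T ?f ?x ?v ?y] =>
  is_num x; is_num y; let b := eval compute in (y == x) in
  match b with
  | true => rewrite (@upd_same T f x v)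
  | false => rewrite (@upd_other T f x v y isT)
  end end.

Ltac run := repeat (first [apply: tr_seq | apply: tr_instr; rewrite /=; upd_simp]).

Section ScanLayer.

Variables (E : rel nat) (n k : nat).
Hypothesis E_sym : symmetric E.
Hypothesis E_irr : irreflexive E.
Hypothesis E_lt : forall x y, E x y -> x < n.
Hypothesis E_odd : forall l c, 2 <= l <= k -> size c = 2 * l + 1 -> uniq c ->
  ~~ cycle E c.

Local Notation A := 20.

Section Scan.

Variables (src to sz : nat -> nat) (root b0 b1 g0 g : nat).

Definition targets (nd : nat -> seq nat) x := [seq to e | e <- nd x].

(** The queue consists of the earlier layers, the current one and the next. [sz] bounds the lengths
    of the lists at the start of the search, so that short lists stay short. [sc_root] serves a
    search that stops at its root: every arc kept there has discovered a vertex. *)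
Record scanning (u pos : nat) (tn dn : nat -> seq nat) (par : nat -> nat)
    (s : state) : Prop := Scanning {
  sc_search : searching E n k (targets tn) (targets dn) (arrs s aDead)
    (arrs s aLay) par (regs s rF) g0 g root u;
  sc_owned : owned src (fun x => tn x ++ dn x);
  sc_pos : pos <= b1 <= regs s rQt;
  sc_cur : pos < b1 -> arrs s aQue pos = u;
  sc_inj : forall i j, i < regs s rQt -> j < regs s rQt ->
    arrs s aQue i = arrs s aQue j -> i = j;
  sc_lay0 : forall i, i < b0 -> g0 <= arrs s aLay (arrs s aQue i) < g;
  sc_lay1 : forall i, b0 <= i < b1 -> arrs s aLay (arrs s aQue i) = g;
  sc_lay2 : forall i, b1 <= i < regs s rQt -> arrs s aLay (arrs s aQue i) = g.+1;
  sc_que : forall x, g0 <= arrs s aLay x ->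
    exists2 i, i < regs s rQt & arrs s aQue i = x;
  sc_old : forall i, i < pos -> tn (arrs s aQue i) = [::];
  sc_fresh : forall i, pos < i < b1 -> dn (arrs s aQue i) = [::];
  sc_size : forall x, size (tn x) + size (dn x) <= sz x;
  sc_first : 0 < regs s rQt /\ arrs s aQue 0 = root;
  sc_root : g = g0 -> size (dn root) < regs s rQt }.

(* Every unit of weight, every queued vertex and every scanned vertex is worth
   [A] steps; the last two are debts, settled when the search ends. *)
Definition credit (base : nat) (tn dn : nat -> seq nat) (pos c : nat) (s : state) :=
  base + A * vsum n (weight (targets tn) (targets dn) (arrs s aDead) (arrs s aLay))
    <= c + A * (regs s rQt + pos).

Definition scan_inv base u pos c s : Prop :=
  exists tn dn par,
    [/\ scanning u pos tn dn par s,
        open_lists (arrs s aHead) (arrs s aNext) tn dn u (regs s rX)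
      & credit base tn dn pos c s].

Lemma sc_visited u pos tn dn par s i : scanning u pos tn dn par s ->
  i < regs s rQt -> g0 <= arrs s aLay (arrs s aQue i) <= g.+1.
Proof.
move=> sc lt_i; have hg := srch_g (sc_search sc).
case: (ltnP i b0) => [/(sc_lay0 sc)|le0]; first lia.
case: (ltnP i b1) => [lt1|le1].
  by rewrite (sc_lay1 sc) ?le0 //; lia.
by rewrite (sc_lay2 sc) ?le1 //; lia.
Qed.

(** The pigeonhole principle. It bounds the debts in [credit] by [A * (2 * n)], so a large [base]
    guarantees that credits are left. *)
Lemma sc_qt_le u pos tn dn par s : scanning u pos tn dn par s -> regs s rQt <= n.
Proof.
move=> sc; rewrite -[X in X <= _](size_mkseq (arrs s aQue)) -[X in _ <= X](size_iota 0).
apply: uniq_leq_size => [|x].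
  by apply/mkseq_uniqP=> i j; apply: sc_inj sc _ _.
case/mapP=> i; rewrite !mem_iota /= add0n => lt_i ->.
by have /andP[/(srch_alive (sc_search sc))[]] := sc_visited sc lt_i.
Qed.

Lemma scanning_drop u pos tn dn par s s' e r :
  scanning u pos tn dn par s -> arrs s aLay u = g -> tn u = e :: r ->
  arrs s' aDead = arrs s aDead -> arrs s' aLay = arrs s aLay ->
  arrs s' aQue = arrs s aQue -> regs s' rQt = regs s rQt ->
  (regs s' rF = 0 -> regs s rF = 0 /\
    ((forall z, ~~ triangle E u (to e) z) \/ to e \in targets dn u)) ->
  (regs s' rF <> 0 -> exists x y z, triangle E x y z) ->
  scanning u pos (upd tn u r) dn par s'.
Proof.
move=> sc lu tu dE lE qE qtE f0 f1; split; rewrite ?dE ?lE ?qE ?qtE;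
  try by case: sc.
- apply: (searching_drop (sc_search sc) lu (y := to e) (rem := [seq to e | e <- r])) => //.
  + by rewrite /targets tu.
  + by move=> x /eqP ne; rewrite /targets upd_other.
  + by rewrite /targets upd_same.
- apply: owned_drop tu _ _ (sc_owned sc); rewrite ?upd_same //.
  by move=> x ne; rewrite upd_other //; apply/eqP.
- move=> i lt_i; rewrite /upd; case: eqP => [eq_u|_]; last exact: sc_old sc _ _.
  by have := sc_old sc lt_i; rewrite eq_u tu.
- move=> x; rewrite /upd; case: eqP => [->|_]; last exact: (sc_size sc).
  by have := sc_size sc u; rewrite tu /=; lia.
Qed.

Lemma scan_arc_inv base u pos c s :
  regs s rZ = 0 -> regs s rOne = 1 -> regs s rG0 = g0 -> regs s rG = g ->
  regs s rG1 = g.+1 -> regs s rU = u -> arrs s aTo = to ->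
  b0 <= pos < b1 -> 0 < regs s rX ->
  A * (2 * n) + 20 <= base ->
  scan_inv base u pos c s ->
  20 <= c /\ tr scan_arc c.-1 s (scan_inv base u pos).
Proof.
move=> Z One G0 G G1 U To hpos X_gt0 hbase [tn [dn [par [sc op cr]]]].
have uE : arrs s aQue pos = u by apply: (sc_cur sc); lia.
have qt_n := sc_qt_le sc.
have ge_c : 20 <= c by have := sc_pos sc; move: cr; rewrite /credit; lia.
split=> //.
have [c' cE] := credit_split ge_c; rewrite {}cE /= in cr *.
have lu : arrs s aLay u = g by rewrite -uE (sc_lay1 sc).
have [op1 op2 op3] := op.
have [r [tu chr]] := chain_cons X_gt0 op3.
set e := regs s rX in tu chr *.
have S := sc_search sc; have hg := srch_g S.
have todo_u : targets tn u = to e :: [seq to e | e <- r] by rewrite /targets tu.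
have upd_tn T (f : nat -> T) v x : x <> u -> upd f u v x = f x.
  by move=> ne; rewrite upd_other //; apply/eqP.
have todo_other x : x <> u -> targets (upd tn u r) x = targets tn x.
  by move=> ne; rewrite /targets upd_tn.
have done_other x : x <> u -> targets (upd dn u (e :: dn u)) x = targets dn x.
  by move=> ne; rewrite /targets upd_tn.
have todo_u' : targets (upd tn u r) u = [seq to e | e <- r].
  by rewrite /targets upd_same.
have done_u : targets (upd dn u (e :: dn u)) u = to e :: targets dn u.
  by rewrite /targets upd_same.
have Euy := arc_edge S todo_u.
have opd : open_lists (arrs s aHead) (arrs s aNext) (upd tn u r) dn u (arrs s aNext e).
  exact: open_lists_drop tu (upd_tn _ tn r) (upd_same _ _ _) op.
have opk : open_lists (upd (arrs s aHead) u e) (upd (arrs s aNext) e (arrs s aHead u))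
    (upd tn u r) (upd dn u (e :: dn u)) u (arrs s aNext e).
  exact: open_lists_keep (sc_owned sc) tu (upd_tn _ tn r) (upd_same _ _ _)
    (upd_tn _ dn _) (upd_same _ _ _) op.
have owk := owned_keep tu (upd_tn _ tn r) (upd_same _ _ _) (upd_tn _ dn _)
  (upd_same _ _ _) (sc_owned sc).
have wd := weight_drop S lu todo_u todo_other (fun=> fun=> erefl) todo_u' erefl.
run; rewrite ?Z ?G0 ?G ?G1 ?U ?To -/e.
apply: tr_if; rewrite /=; upd_simp; rewrite Z; case: eqP => [alive|ndead]; last first.
  run; exists (upd tn u r), dn, par; split; rewrite /credit /=; upd_simp => //.
    apply: (scanning_drop sc lu tu); rewrite //=; upd_simp => //.
    - move=> f0; split=> //; left=> z; apply/negP=> t.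
      by have [_] := sound_tri (srch_sound S) f0 (triangle_rot t).
    - by move=> f1; apply: sound_fnd (srch_sound S) f1.
  by move: cr; rewrite /credit; lia.
run; apply: tr_if; rewrite /=; upd_simp; rewrite G0; case: (ltnP _ g0) => [new|old].
  run; rewrite ?Z ?G0 ?G ?G1 ?U ?To -/e.
  exists (upd tn u r), (upd dn u (e :: dn u)), (upd par (to e) u).
  (* Queued vertices carry stamps of at least [g0], so appending [to e] creates no repetition in the
     queue. *)
  have neq_q i : i < regs s rQt -> arrs s aQue i != to e.
    by move=> /(sc_visited sc) h; apply/eqP=> eq_q; rewrite eq_q in h; lia.
  have wn := weight_new S lu todo_u todo_other done_other todo_u' new alive done_u.
  split; rewrite ?/credit /=; upd_simp => //.
    have hp := sc_pos sc.
    split; rewrite /=; upd_simp => //.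
    - exact: searching_new S lu todo_u todo_other done_other todo_u' new alive done_u.
    - lia.
    - by move=> _; rewrite upd_other ?uE //; lia.
    - have fresh i : i < regs s rQt -> upd (arrs s aQue) (regs s rQt) (to e) i = arrs s aQue i.
        by move=> lt_i; rewrite upd_other // neq_ltn lt_i.
      move=> i j; rewrite ltnS leq_eqVlt => /orP[/eqP->|lt_i];
        rewrite ltnS leq_eqVlt => /orP[/eqP->|lt_j] //.
      + by rewrite upd_same fresh // => eq_q; have := neq_q _ lt_j; rewrite eq_q eqxx.
      + by rewrite upd_same fresh // => eq_q; have := neq_q _ lt_i; rewrite eq_q eqxx.
      + by rewrite !fresh //; apply: (sc_inj sc).
    - move=> i lt_i; rewrite (@upd_other _ (arrs s aQue)); last lia.
      by rewrite upd_other ?neq_q ?(sc_lay0 sc) //; lia.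
    - move=> i lt_i; rewrite (@upd_other _ (arrs s aQue)); last lia.
      by rewrite upd_other ?neq_q ?(sc_lay1 sc) //; lia.
    - move=> i lt_i; case: (eqVneq i (regs s rQt)) => [->|ne].
        by rewrite upd_same upd_same.
      rewrite (@upd_other _ (arrs s aQue)) //.
      by rewrite upd_other ?neq_q ?(sc_lay2 sc) //; lia.
    - move=> x; case: (eqVneq x (to e)) => [-> _|ne].
        by exists (regs s rQt); rewrite ?upd_same.
      rewrite upd_other // => /(sc_que sc)[i lt_i qi]; exists i; first lia.
      by rewrite upd_other //; lia.
    - move=> i lt_i; rewrite (@upd_other _ (arrs s aQue)); last lia.
      rewrite /upd; case: eqP => [eq_u|_]; last exact: sc_old sc _ _.
      by have := sc_old sc lt_i; rewrite eq_u tu.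
    - move=> i lt_i; rewrite (@upd_other _ (arrs s aQue)); last lia.
      rewrite upd_tn ?(sc_fresh sc) // -uE => /(sc_inj sc); lia.
    - move=> x; case: (eqVneq x u) => [->|/eqP ne]; last by rewrite !upd_tn //; apply: (sc_size sc).
      by rewrite !upd_same; have := sc_size sc u; rewrite tu /=; lia.
    - have [qt_gt0 q0] := sc_first sc.
      by rewrite upd_other //; lia.
    - move=> eg; have := sc_root sc eg; rewrite /upd; case: eqP => [->|_] /=; lia.
  (* The weight is unchanged; the increment of [rQt] raises the debt by [A], which pays for this
     arc. *)
  by rewrite wn; move: cr; rewrite /credit; lia.
run; apply: tr_if; rewrite /=; upd_simp; rewrite G; case: (ltnP _ g) => [low|high].
  run; rewrite ?Z ?G0 ?G ?G1 ?U ?To -/e.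
  exists (upd tn u r), (upd dn u (e :: dn u)), par.
  have hy : g0 <= arrs s aLay (to e) < g by lia.
  have wl := weight_low S lu todo_u todo_other done_other todo_u' low alive done_u.
  split; rewrite ?/credit /=; upd_simp => //.
    split; rewrite /=; upd_simp => //; try by case: sc.
    - exact: searching_low S lu todo_u todo_other done_other todo_u' hy done_u.
    - move=> i lt_i; rewrite /upd; case: eqP => [eq_u|_]; last exact: sc_old sc _ _.
      by have := sc_old sc lt_i; rewrite eq_u tu.
    - move=> i lt_i.
      by rewrite upd_tn ?(sc_fresh sc) // -uE => /(sc_inj sc); have := sc_pos sc; lia.
    - move=> x; case: (eqVneq x u) => [->|/eqP ne]; last by rewrite !upd_tn //; apply: (sc_size sc).
      by rewrite !upd_same; have := sc_size sc u; rewrite tu /=; lia.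
    - move=> eg; lia.
  by move: cr; rewrite /credit; lia.
(* An edge inside a layer proves that a triangle exists; from then on any arc may be dropped. *)
run; apply: tr_if; rewrite /=; upd_simp; rewrite G; case: eqP => [same|nsame].
  run; exists (upd tn u r), dn, par; split; rewrite /credit /=; upd_simp => //.
    apply: (scanning_drop sc lu tu); rewrite //=; upd_simp; rewrite ?One //.
    move=> _; have eq_lay : arrs s aLay u = arrs s aLay (to e) by rewrite lu same.
    have lay_k : g0 <= arrs s aLay u <= g0 + k by rewrite lu; lia.
    exact: (same_layer_triangle E_sym E_irr E_odd (srch_tree S) eq_lay lay_k Euy).
  by move: cr; rewrite /credit; lia.
(* Only the next layer is left: the target already has another parent, or the arc repeats its tree
   arc. *)
have layy : arrs s aLay (to e) = g.+1 by have := srch_lay S (to e); lia.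
run; exists (upd tn u r), dn, par; split; rewrite /credit /=; upd_simp => //.
  apply: (scanning_drop sc lu tu); rewrite //=; upd_simp => //.
  - move=> f0; split=> //.
    exact: (no_triangle_nontree E_sym E_irr E_odd S lu).
  - by move=> f1; apply: sound_fnd (srch_sound S) f1.
by move: cr; rewrite /credit; lia.
Qed.

Definition scan_mid base pos c s : Prop :=
  exists u tn dn par,
    [/\ scanning u pos tn dn par s, tn u = [::] \/ dn u = [::],
        lists (arrs s aHead) (arrs s aNext) (fun x => tn x ++ dn x),
        pos < b1 -> dn (arrs s aQue pos) = [::] & credit base tn dn pos c s].

Definition scan_regs s :=
  [/\ regs s rZ = 0, regs s rOne = 1, regs s rG0 = g0, regs s rG = g
    & regs s rG1 = g.+1 /\ arrs s aTo = to].

Lemma scan_body_ok base pos c s :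
  scan_regs s -> regs s rPos = pos -> b0 <= pos < b1 ->
  A * (2 * n) + 30 <= base -> scan_mid base pos c s ->
  0 < c /\ tr (ILoad rU aQue rPos ;; scan_list ;; ISucc rPos rPos) c.-1 s
    (fun c' s' => regs s' rPos = pos.+1 /\ scan_mid base pos.+1 c' s').
Proof.
move=> [Z One G0 G [G1 To]] posE hpos hbase [u0 [tn [dn [par [sc one ls fresh cr]]]]].
have qt_n := sc_qt_le sc.
have ge_c : 20 <= c by have := sc_pos sc; move: cr; rewrite /credit; lia.
split; first lia.
have [c' cE] := credit_split ge_c; rewrite {}cE /= in cr *.
set u := arrs s aQue pos in fresh.
run; rewrite posE Z -/u.
have du : dn u = [::] by apply: fresh; lia.
have u0E : u0 = u by rewrite -(sc_cur sc) //; lia.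
(* Four steps have been taken: the test of the outer loop and three instructions. The debt incurred
   by moving on to [pos.+1] restores them. *)
apply: (tr_while (I := scan_inv (base - 4) u pos)).
  exists tn, dn, par; split; rewrite /credit /=; upd_simp.
  - by case: sc => S *; split; rewrite /=; upd_simp; rewrite -?u0E.
  - exact: open_lists_start.
  - by move: cr; rewrite /credit; lia.
move=> c1 s1 [fr fa] I1.
have [tn1 [dn1 [par1 [sc1 op1 cr1]]]] := I1.
have U1 : regs s1 rU = u by rewrite fr //=; upd_simp.
have Z1 : regs s1 rZ = 0 by rewrite fr //=; upd_simp.
have P1 : regs s1 rPos = pos by rewrite fr //=; upd_simp.
rewrite /= Z1; case: (ltnP 0 (regs s1 rX)) => [X_gt0|X0].
  have [|||||||ge1 t] := @scan_arc_inv (base - 4) u pos c1 s1 _ _ _ _ _ U1 _ hpos X_gt0 _ I1;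
    try (by rewrite fr //=; upd_simp); try (by rewrite fa //=; upd_simp).
  by lia.
  by split=> //; lia.
have qt1_n := sc_qt_le sc1.
have ge_c1 : 20 <= c1 by have := sc_pos sc1; move: cr1; rewrite /credit; lia.
split; first lia.
have [c2 c2E] := credit_split ge_c1; rewrite {}c2E /= in cr1 *.
move: X0; rewrite leqn0 => /eqP X0; rewrite X0 in op1.
have [ls1 tu1] := open_lists_end op1.
run; split; first by rewrite P1.
exists (if pos.+1 < b1 then arrs s1 aQue pos.+1 else u), tn1, dn1, par1.
have cur1 : arrs s1 aQue pos = u by apply: (sc_cur sc1); lia.
have sc1' := sc1; case: sc1' => S ow sp _ inj l0 l1 l2 que old fr1 szs fst rt.
split; rewrite /credit /=; upd_simp => //.
- split; rewrite /=; upd_simp => //.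
  + by apply: searching_current S _; left; rewrite /targets tu1.
  + by lia.
  + by move=> ->.
  + by move=> i; rewrite ltnS leq_eqVlt => /orP[/eqP->|/old//]; rewrite cur1.
  + by move=> i lt_i; apply: fr1; lia.
- by case: ifP => [lt1|_]; [right; apply: fr1; lia|left].
- by move=> lt1; apply: fr1; lia.
- by move: cr1; rewrite /credit; lia.
Qed.

(** The first instruction and the last test are charged to no vertex, hence the loss of 2 from
    [base]. *)
Lemma scan_layer_ok base c s :
  scan_regs s -> regs s rB0 = b0 -> regs s rB1 = b1 -> b0 <= b1 ->
  A * (2 * n) + 40 <= base -> scan_mid base b0 c s ->
  tr scan_layer c s (fun c' s' => scan_mid (base - 2) b1 c' s').
Proof.
move=> [Z One G0 G [G1 To]] B0 B1 le_b hbase mid.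
have ge_c : 20 <= c.
  have [u [tn [dn [par [sc _ _ _ cr]]]]] := mid.
  by have := sc_pos sc; have := sc_qt_le sc; move: cr; rewrite /credit; lia.
have [c' cE] := credit_split ge_c; rewrite {}cE /= in mid *.
run; rewrite B0.
apply: (tr_while (I := fun c s => [/\ b0 <= regs s rPos, regs s rPos <= b1 &
  scan_mid (base - 1) (regs s rPos) c s])).
  rewrite /=; upd_simp; split=> //.
  have [u [tn [dn [par [sc one ls fresh cr]]]]] := mid.
  exists u, tn, dn, par; split; rewrite /credit /=; upd_simp => //.
    by case: sc.
  by move: cr; rewrite /credit; lia.
move=> c1 s1 [fr fa] [le0 le1 mid1].
have B1' : regs s1 rB1 = b1 by rewrite fr //=; upd_simp.
rewrite /= B1'; case: (ltnP (regs s1 rPos) b1) => [lt1|ge1].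
  have [|||gt0 t] := @scan_body_ok (base - 1) (regs s1 rPos) c1 s1 _ erefl _ _ mid1;
    rewrite ?le0 //; try lia.
    by split; rewrite ?fr ?fa //=; upd_simp.
  split=> //; apply: tr_conseq t _ => c2 s2 _ [pE mid2].
  by rewrite pE; split=> //; lia.
have posE : regs s1 rPos = b1 by lia.
rewrite posE in mid1; have [u [tn [dn [par [sc one ls fresh cr]]]]] := mid1.
have ge_c1 : 20 <= c1.
  by have := sc_pos sc; have := sc_qt_le sc; move: cr; rewrite /credit; lia.
split; first lia.
exists u, tn, dn, par; split => //.
by move: cr; rewrite /credit; lia.
Qed.

Lemma scan_mid_frame base base' pos c c' s s' :
  scan_mid base pos c s -> arrs s' =1 arrs s ->
  regs s' rF = regs s rF -> regs s' rQt = regs s rQt -> base' + c <= base + c' ->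
  scan_mid base' pos c' s'.
Proof.
move=> [u [tn [dn [par [[]]]]]] S ow sp cur inj l0 l1 l2 que old fr szs fst rt one ls fresh cr.
move=> aE fE qE le_c.
exists u, tn, dn, par; split; rewrite ?/credit ?aE ?qE //.
  by split; rewrite ?aE ?qE ?fE.
by move: cr; rewrite /credit; lia.
Qed.

Lemma scan_mid_credit base pos c s : scan_mid base pos c s ->
  base <= c + A * (2 * n).
Proof.
move=> [u [tn [dn [par [sc _ _ _ cr]]]]].
by have := sc_pos sc; have := sc_qt_le sc; move: cr; rewrite /credit; lia.
Qed.

Lemma sc_done u pos tn dn par s x : scanning u pos tn dn par s -> pos = b1 ->
  g0 <= arrs s aLay x <= g -> tn x = [::].
Proof.
move=> sc posE hx; have [i lt_i qi] := sc_que sc (x := x) ltac:(lia).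
rewrite -qi; apply: (sc_old sc); rewrite posE ltnNge; apply/negP=> ge_i.
by have := sc_lay2 sc (i := i); rewrite ge_i lt_i qi => /(_ isT); lia.
Qed.

Lemma sc_unseen u pos tn dn par s i : scanning u pos tn dn par s ->
  b1 <= i < regs s rQt -> dn (arrs s aQue i) = [::].
Proof.
move=> sc hi; have l2 := sc_lay2 sc hi.
case dE : (dn (arrs s aQue i)) => [|e d] //.
have [] := srch_done (sc_search sc) (x := arrs s aQue i) (y := to e);
  last by rewrite l2; lia.
by rewrite /targets dE mem_head.
Qed.

End Scan.

(** The layer just discovered becomes the current one. Its vertices have no kept arcs yet, since
    those start on scanned layers. *)
Lemma scan_mid_next src to sz root b0 b1 g0 g base c s :
  scan_mid src to sz root b0 b1 g0 g base b1 c s -> b0 <= b1 ->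
  g.+1 < g0 + k ->
  scan_mid src to sz root b1 (regs s rQt) g0 g.+1 base b1 c s.
Proof.
move=> [u [tn [dn [par [sc one ls fresh cr]]]]] le_b lt_g.
exists (if b1 < regs s rQt then arrs s aQue b1 else u), tn, dn, par.
have unseen := sc_unseen sc; have alldone := sc_done sc erefl.
case: (sc) => S ow sp _ inj l0 l1 l2 que old fr szs fst rt.
have hg := srch_g S.
split=> //.
- split=> //; try lia.
  + by apply: searching_next S _ lt_g => x hx; rewrite /targets alldone.
  + by move=> ->.
  + move=> i lt_i; case: (ltnP i b0) => [/l0|ge_i]; first lia.
    by rewrite l1 ?ge_i //; lia.
  + by move=> i hi; apply: unseen; lia.
- by case: ifP => // lt_b; right; apply: unseen; rewrite leqnn.
- by move=> lt_b; apply: unseen; rewrite leqnn.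
Qed.

End ScanLayer.

(** * Arithmetic by counting loops, and deletion of vertices *)

Definition add_to (z y t : nat) : prog :=
  IConst t 0 ;; PWhile (TLt t y) (ISucc t t ;; ISucc z z).

Lemma add_to_ok z y t c c0 s : uniq [:: z; y; t] -> c0 + 3 * regs s y + 2 <= c ->
  tr (add_to z y t) c s (fun c' s' => c0 <= c' /\ regs s' z = regs s z + regs s y).
Proof.
rewrite /= !inE !negb_or !andbT => /andP[/andP[zy zt] yt] le_c.
have [c' cE] := @credit_split 2 c ltac:(lia); rewrite {}cE /= in le_c *.
apply: tr_seq; apply: tr_instr.
apply: (tr_while (I := fun c1 s1 => [/\ regs s1 t <= regs s y,
  regs s1 z = regs s z + regs s1 t & c0 + 3 * (regs s y - regs s1 t) + 1 <= c1])).
  by rewrite /= upd_same upd_other // addn0; split=> //; lia.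
move=> c1 s1 [fr _] [le_t zE le_c1]; split; first lia.
have yE : regs s1 y = regs s y by rewrite fr /= ?upd_other // !inE negb_or yt eq_sym.
rewrite /= yE; case: ltnP => [lt_t|ge_t]; last by split; lia.
have [c2 c1E] := @credit_split 3 c1 ltac:(lia); rewrite {}c1E /= in le_c1 *.
apply: tr_seq; apply: tr_instr; apply: tr_instr.
have tz : t != z by rewrite eq_sym.
by rewrite /= !(upd_other _ _ tz) !(upd_other _ _ zt) !upd_same; split; lia.
Qed.

(** The counter [i] is not reset. In a search it remembers how many vertices the budget already
    accounts for, so the budget is updated incrementally and the cost of all updates telescopes. *)
Definition add_mul (z x y i t : nat) : prog :=
  PWhile (TLt i x) (ISucc i i ;; add_to z y t).

Lemma add_mul_ok z x y i t c c0 s : uniq [:: z; x; y; i; t] ->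
  regs s i <= regs s x ->
  c0 + (3 * regs s y + 4) * (regs s x - regs s i) + 1 <= c ->
  tr (add_mul z x y i t) c s (fun c' s' => [/\ c0 <= c', regs s' i = regs s x &
    regs s' z = regs s z + regs s y * (regs s x - regs s i)]).
Proof.
move=> un; move: (un).
rewrite /= !inE !negb_or !andbT -!andbA.
move=> /and5P[zx zy zi zt /and5P[xy xi xt yi /andP[yt it]]] le_i le_c.
apply: (tr_while (I := fun c1 s1 => [/\ regs s i <= regs s1 i <= regs s x,
  regs s1 z = regs s z + regs s y * (regs s1 i - regs s i) &
  c0 + (3 * regs s y + 4) * (regs s x - regs s1 i) + 1 <= c1])).
  by split; rewrite ?subnn ?muln0; lia.
move=> c1 s1 [fr _] [le_i1 zE le_c1]; split.
  by apply: leq_trans le_c1; rewrite addn1.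
have xE : regs s1 x = regs s x.
  by rewrite fr //= !inE !negb_or xi xt eq_sym zx.
have yE : regs s1 y = regs s y.
  by rewrite fr //= !inE !negb_or yi yt eq_sym zy.
rewrite /= xE; case: ltnP => [lt_i|ge_i]; last first.
  have -> : regs s1 i = regs s x by lia.
  by split; [lia|lia|rewrite zE; congr (_ + _ * _); lia].
have eq1 : regs s x - regs s1 i = (regs s x - (regs s1 i).+1).+1 by lia.
rewrite eq1 mulnS in le_c1.
set rest := (3 * regs s y + 4) * (regs s x - (regs s1 i).+1) in le_c1.
have [c2 c1E] := @credit_split 2 c1 ltac:(lia); rewrite {}c1E /= in le_c1 *.
apply: tr_seq; apply: tr_instr.
set s2 := step _ _.
have y2 : regs s2 y = regs s y by rewrite /s2 /= upd_other.
apply: (tr_conseq (@add_to_ok z y t _ (c0 + rest + 1) s2 _ _)).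
- by rewrite /= !inE !negb_or zy zt yt.
- by rewrite y2; lia.
move=> c3 s3 [fr3 _] [le_c3 z3]; rewrite y2 in z3.
have i3 : regs s3 i = (regs s1 i).+1.
  by rewrite fr3 /= ?upd_same // !inE !negb_or it eq_sym zi.
split; rewrite ?i3 //; first lia.
rewrite z3 /s2 /= upd_other // zE -addnA; congr (_ + _).
by rewrite -mulnSr; congr (_ * _); lia.
Qed.

Definition kill : prog :=
  ICopy rPos rZ ;;
  PWhile (TLt rPos rB0)
    (ILoad rU aQue rPos ;; IStore aHead rU rZ ;; IStore aDead rU rOne ;;
     ISucc rPos rPos).

Lemma kill_ok c c0 s :
  regs s rZ = 0 -> regs s rOne = 1 -> c0 + 5 * regs s rB0 + 2 <= c ->
  tr kill c s (fun c' s' => [/\ c0 <= c',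
    forall x, arrs s' aHead x =
      if x \in mkseq (arrs s aQue) (regs s rB0) then 0 else arrs s aHead x &
    forall x, arrs s' aDead x =
      if x \in mkseq (arrs s aQue) (regs s rB0) then 1 else arrs s aDead x]).
Proof.
move=> Z One le_c.
have [c' cE] := @credit_split 2 c ltac:(lia); rewrite {}cE /= in le_c *.
run; rewrite Z.
apply: (tr_while (I := fun c1 s1 => [/\ regs s1 rPos <= regs s rB0,
    c0 + 5 * (regs s rB0 - regs s1 rPos) + 1 <= c1,
    forall x, arrs s1 aHead x =
      if x \in mkseq (arrs s aQue) (regs s1 rPos) then 0 else arrs s aHead x &
    forall x, arrs s1 aDead x =
      if x \in mkseq (arrs s aQue) (regs s1 rPos) then 1 else arrs s aDead x])).
  by rewrite /=; upd_simp; split=> //; lia.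
move=> c1 s1 [fr fa] [le_pos le_c1 hdE ddE]; split; first lia.
have B0 : regs s1 rB0 = regs s rB0 by rewrite fr //=; upd_simp.
have Z1 : regs s1 rZ = 0 by rewrite fr //=; upd_simp.
have One1 : regs s1 rOne = 1 by rewrite fr //=; upd_simp.
have qE : arrs s1 aQue = arrs s aQue by rewrite fa.
rewrite /= B0; case: ltnP => [lt_pos|ge_pos]; last first.
  have posE : regs s1 rPos = regs s rB0 by lia.
  by rewrite posE in hdE ddE; split=> //; lia.
have [c2 c1E] := @credit_split 5 c1 ltac:(lia); rewrite {}c1E /= in le_c1 *.
run; rewrite Z1 One1 qE; split; try lia.
  by move=> x; rewrite mkseqS mem_rcons inE /upd hdE; case: eqP.
by move=> x; rewrite mkseqS mem_rcons inE /upd ddE; case: eqP.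
Qed.

(** * One search *)

(* After this step [rB0] counts the vertices above the layer just scanned, and
   [rQt] those up to the layer below it. *)
Definition deepen : prog :=
  ICopy rB0 rB1 ;; ICopy rB1 rQt ;; ICopy rG rG1 ;; ISucc rG1 rG1 ;;
  scan_layer ;; add_mul rBud rB0 rQ rCp rL.

Definition round : prog :=
  IStore aLay rV rG0 ;; IStore aQue rZ rV ;; ICopy rQt rOne ;; ICopy rB0 rZ ;;
  ICopy rB1 rOne ;; ICopy rG rG0 ;; ISucc rG1 rG ;; ICopy rCp rZ ;;
  ICopy rBud rD ;; scan_layer ;; PWhile (TLt rBud rQt) deepen ;; kill ;;
  ISucc rG1 rG1 ;; ICopy rG0 rG1.

Lemma count_kill (d d' : nat -> nat) (B : seq nat) n : uniq B ->
  (forall x, x \in B -> x < n /\ d x = 0) ->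
  (forall x, d' x = if x \in B then 1 else d x) ->
  count (fun x => d' x == 0) (iota 0 n) + size B
    <= count (fun x => d x == 0) (iota 0 n).
Proof.
move=> unB BP dE.
have -> : size B = count [in B] (iota 0 n).
  rewrite -size_filter; apply: perm_size; apply: uniq_perm => //.
    by rewrite filter_uniq ?iota_uniq.
  move=> x; rewrite mem_filter mem_iota add0n /=.
  by case: (boolP (x \in B)) => // /BP[-> _].
rewrite -count_predUI.
have -> : count (predI (fun x => d' x == 0) [in B]) (iota 0 n) = 0.
  by rewrite (eq_count (a2 := pred0)) ?count_pred0 // => x /=;
    rewrite dE; case: (x \in B) => //=; rewrite andbF.
rewrite addn0; apply: sub_count => x /=; rewrite dE.
by case: (boolP (x \in B)) => [/BP[_ ->]|_] //=; rewrite orbF.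
Qed.

Section Round.

Variables (E : rel nat) (n k : nat).
Hypothesis E_sym : symmetric E.
Hypothesis E_irr : irreflexive E.
Hypothesis E_lt : forall x y, E x y -> x < n.
Hypothesis E_odd : forall l c, 2 <= l <= k -> size c = 2 * l + 1 -> uniq c ->
  ~~ cycle E c.
Hypothesis k_gt0 : 0 < k.

Variables (src to : nat -> nat) (D : nat).
Hypothesis D_gt0 : 0 < D.
Hypothesis D_pow : n <= D ^ k.

Local Notation A := 20.
Local Notation Q := (D * D).

(* Covers the debts of a search until they are settled; it is never spent. *)
Definition reserve := A * (2 * n) + 10 * k + (3 * Q + 4) * n + 10 * n + 100.

Section Deepen.

Variables (sz : nat -> nat) (root g0 : nat).

(** Here [j] is the layer scanned last; the first [b0] queue entries form the layers before it, and
    the first [b1] include it. The last two fields are the exponential growth that forces the search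
    to stop. *)
Record deep (base j b0 b1 : nat) (s : state) : Prop := Deep {
  dp_B0 : regs s rB0 = b0;
  dp_B1 : regs s rB1 = b1;
  dp_G : regs s rG = g0 + j;
  dp_G1 : regs s rG1 = (g0 + j).+1;
  dp_Cp : regs s rCp = b0;
  dp_Bud : regs s rBud = D + Q * b0;
  dp_le : b0 <= b1;
  dp_b1 : D ^ j <= b1;
  dp_b0 : if j is j'.+1 then D ^ j' <= b0 else b0 = 0 }.

(** Of the initial [base], [b] is left: each deepening has taken at most 10, and the updates of the
    budget together [(3 * Q + 4) * b0]. *)
Definition deep_inv base c s : Prop := exists j b0 b1 b,
  [/\ deep base j b0 b1 s, base <= b + 10 * j + (3 * Q + 4) * b0 &
    scan_mid E n k src to sz root b0 b1 g0 (g0 + j) b b1 c s].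

Definition round_regs s :=
  [/\ regs s rZ = 0, regs s rOne = 1, regs s rG0 = g0, regs s rQ = Q
    & arrs s aTo = to].

Lemma deepen_ok base c s : round_regs s -> reserve <= base ->
  regs s rBud < regs s rQt -> deep_inv base c s ->
  0 < c /\ tr deepen c.-1 s (deep_inv base).
Proof.
rewrite /reserve => -[Z One G0 RQ To] hbase.
move=> lt_bud [j [b0 [b1 [b [[B0 B1 G G1 Cp Bud le_b pow1 pow0]] le_base mid]]]].
have [u [tn [dn [par [sc _ _ _ _]]]]] := mid.
have qt_n := sc_qt_le sc; have [_ le_qt] := andP (sc_pos sc).
have hg := srch_g (sc_search sc).
rewrite Bud in lt_bud.
(* For [j = 0] the budget is [D] itself; for [j = j'.+1] it exceeds [Q * b0 >= D ^ 2 * D ^ j']. *)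
have pow2 : D ^ j.+1 < regs s rQt.
  case: {+}j pow0 => [|j'] h; first by rewrite expn1; lia.
  have : Q * D ^ j' <= Q * b0 by rewrite leq_mul2l h orbT.
  by rewrite !expnS mulnA; lia.
(* Otherwise more than [D ^ k >= n] vertices would be in the queue. *)
have lt_j : j.+1 < k.
  rewrite ltnNge; apply/negP=> ge_k; have jk : j.+1 = k by lia.
  by move: pow2; rewrite jk; lia.
have mulb0 : (3 * Q + 4) * b0 <= (3 * Q + 4) * n by rewrite leq_mul2l; lia.
have mulb1 : (3 * Q + 4) * b1 <= (3 * Q + 4) * n by rewrite leq_mul2l; lia.
have crd := scan_mid_credit mid.
have [c' cE] := @credit_split 5 c ltac:(lia); rewrite {}cE /= in crd mid *.
split=> //.
have mid' := scan_mid_next mid le_b ltac:(lia).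
rewrite /deepen; do 4 (apply: tr_seq; apply: tr_instr; rewrite /=; upd_simp).
apply: tr_seq; rewrite B1 G1.
set s2 := set_reg _ _ _.
have mid2 : scan_mid E n k src to sz root b1 (regs s rQt) g0 (g0 + j).+1 (b - 5) b1 c' s2.
  by apply: scan_mid_frame mid' _ _ _ _; rewrite //=; upd_simp => //; lia.
have t := @scan_layer_ok E n k E_sym E_irr E_lt E_odd src to sz root b1 (regs s rQt)
  g0 (g0 + j).+1 (b - 5) c' s2.
apply: (tr_conseq (t _ _ _ _ _ mid2)); rewrite /s2.
- by split; rewrite /=; upd_simp.
- by rewrite /=; upd_simp.
- by rewrite /=; upd_simp.
- by [].
- by lia.
move=> c3 s3 [fr fa] mid3.
have [u3 [tn3 [dn3 [par3 [sc3 _ _ _ _]]]]] := mid3.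
have qt3_n := sc_qt_le sc3.
have crd3 := scan_mid_credit mid3.
have B0' : regs s3 rB0 = b1 by rewrite fr //=; upd_simp.
have Cp' : regs s3 rCp = b0 by rewrite fr //=; upd_simp.
have Q' : regs s3 rQ = Q by rewrite fr //=; upd_simp.
have Bud' : regs s3 rBud = D + Q * b0 by rewrite fr //=; upd_simp.
have mulE : (3 * Q + 4) * b1 = (3 * Q + 4) * b0 + (3 * Q + 4) * (b1 - b0).
  by rewrite -mulnDr subnKC.
pose rest := (3 * Q + 4) * (b1 - b0).
apply: (tr_conseq (@add_mul_ok rBud rB0 rQ rCp rL c3 (c3 - (rest + 1)) s3 isT _ _)).
- by rewrite B0' Cp'.
- by rewrite B0' Cp' Q' /rest; lia.
move=> c4 s4 [fr4 fa4] [le_c4 cp4 bud4].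
(* The loop test and four instructions cost 5, the scan loses 2, and the update of the budget costs
   [rest + 1]. *)
exists j.+1, b1, (regs s rQt), (b - 7 - (rest + 1)); split.
- split.
  + by rewrite fr4.
  + by rewrite fr4 // fr //=; upd_simp.
  + by rewrite fr4 // fr //=; upd_simp; rewrite addnS.
  + by rewrite fr4 // fr //=; upd_simp; rewrite addnS.
  + by rewrite cp4.
  + by rewrite bud4 Bud' Q' B0' Cp' -addnA -mulnDr subnKC.
  + by [].
  + exact: ltnW.
  + by [].
- rewrite mulE -/rest; lia.
- rewrite addnS; apply: scan_mid_frame mid3 _ _ _ _.
  + by move=> a; rewrite fa4.
  + by rewrite fr4.
  + by rewrite fr4.
  + lia.
Qed.

End Deepen.

Definition alive (dead : nat -> nat) := count (fun x => dead x == 0) (iota 0 n).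

Record between (v : nat) (nd : nat -> seq nat) (s : state) : Prop := Between {
  bw_sound : sound E (targets to nd) (arrs s aDead) (regs s rF);
  bw_owned : owned src nd;
  bw_lists : lists (arrs s aHead) (arrs s aNext) nd;
  bw_lay : forall x, arrs s aLay x < regs s rG0;
  bw_small : forall x, x < v -> size (nd x) <= D }.

(** The share of a search that no deleted vertex pays: 10 for each of fewer than [k] deepenings, the
    debts [2 * A * D] for the term [D] of the budget, and a constant. *)
Definition round_cost := 10 * k + 2 * A * D + 100.

(** The price of a deleted vertex: [2 * A * Q] for the queue and scan debts, as at most [D + Q * b0]
    vertices are queued when [b0] are deleted, [3 * Q] for computing the budget, and 10 for the rest
    of that and for the deletion loop. *)
Definition kill_cost := 2 * A * Q + 3 * Q + 10.

Definition round_credit (base : nat) (nd : nat -> seq nat) (c : nat) (s : state) :=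
  base + A * vsum n (potential (targets to nd) (arrs s aDead))
    + kill_cost * alive (arrs s aDead) <= c.

Lemma round_credit_ge base nd c s : round_credit base nd c s -> base <= c.
Proof. by clear D_gt0 D_pow k_gt0; rewrite /round_credit; lia. Qed.

Lemma round_credit_frame base base' nd c c' s s' :
  round_credit base nd c s -> arrs s' aDead = arrs s aDead ->
  base' + c <= base + c' -> round_credit base' nd c' s'.
Proof. by clear D_gt0 D_pow k_gt0; rewrite /round_credit => cr ->; lia. Qed.

(** The settlement of a search: the debts are at most [2 * A * (D + Q * b0)], of which [round_cost]
    covers the part with [D] and the [b0] deleted vertices the part with [Q]. *)
Lemma kill_round sz root g0 j b0 b1 b base base0 c0 c v s s' :
  deep g0 base j b0 b1 s -> regs s rQt <= D + Q * b0 ->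
  reserve <= base ->
  base <= b + 10 * j + (3 * Q + 4) * b0 ->
  scan_mid E n k src to sz root b0 b1 g0 (g0 + j) b b1 c s ->
  (forall x, x < v -> sz x <= D) -> root = v ->
  c <= c0 + 5 * b0 + 10 ->
  (forall x, arrs s' aHead x =
    if x \in mkseq (arrs s aQue) b0 then 0 else arrs s aHead x) ->
  (forall x, arrs s' aDead x =
    if x \in mkseq (arrs s aQue) b0 then 1 else arrs s aDead x) ->
  arrs s' aNext = arrs s aNext -> arrs s' aLay = arrs s aLay ->
  regs s' rF = regs s rF -> (g0 + j).+1 < regs s' rG0 ->
  base0 + kill_cost * alive (arrs s aDead) + round_cost <= base + 20 ->
  exists nd, between v.+1 nd s' /\ round_credit base0 nd c0 s'.
Proof.
rewrite /reserve => dp le_qt hbase le_base mid szP rootE le_c hdE ddE nxE lyE fE lt_g0 le_base0.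
have [u [tn [dn [par [sc _ ls _ cr]]]]] := mid.
have S := sc_search sc; have hg := srch_g S; have alldone := sc_done sc erefl.
have spos := sc_pos sc; have qt_n := sc_qt_le sc.
have memB x : (x \in mkseq (arrs s aQue) b0) = (g0 <= arrs s aLay x < g0 + j).
  apply/idP/idP => [/mapP[i]|hx].
    by rewrite mem_iota add0n => /= lt_i ->; apply: (sc_lay0 sc).
  have [i lt_i qi] := sc_que sc (x := x) ltac:(lia).
  apply/mapP; exists i => //; rewrite mem_iota add0n /=.
  rewrite ltnNge; apply/negP=> ge_i; rewrite -qi in hx.
  case: (ltnP i b1) => [lt1|ge1].
    by have := sc_lay1 sc (i := i); rewrite ge_i lt1 => /(_ isT); lia.
  by have := sc_lay2 sc (i := i); rewrite ge1 lt_i => /(_ isT); lia.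
pose nd x := if g0 <= arrs s aLay x < g0 + j then [::] else tn x ++ dn x.
have hdE' x : arrs s' aHead x = if g0 <= arrs s aLay x < g0 + j then 0 else arrs s aHead x.
  by rewrite hdE memB.
have ddE' x : arrs s' aDead x = if g0 <= arrs s aLay x < g0 + j then 1 else arrs s aDead x.
  by rewrite ddE memB.
have tgE x : targets to nd x =
    if g0 <= arrs s aLay x < g0 + j then [::] else targets to tn x ++ targets to dn x.
  by rewrite /targets /nd; case: ifP => // _; rewrite map_cat.
exists nd; split.
  split.
  - rewrite fE; apply: (sound_kill E_sym S _ tgE ddE') => // x hx.
    by rewrite /targets alldone.
  - move=> x; rewrite /nd; case: ifP => // _; exact: (sc_owned sc).
  - by move=> x; rewrite /nd hdE' nxE; case: ifP => // _; apply: ls.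
  - by move=> x; rewrite lyE; have := srch_lay S x; lia.
  (* The list of the root is empty if the root is deleted. Otherwise [b0 = 0] and [j = 0], and its
     kept arcs are fewer than the queued vertices, which the stopping test bounds by [D]. *)
  - move=> x; rewrite ltnS leq_eqVlt => /orP[/eqP->|/szP sx]; last first.
      rewrite /nd; case: ifP => // _; rewrite size_cat.
      exact: leq_trans (sc_size sc x) sx.
    rewrite -rootE; have [qt_gt0 q0] := sc_first sc.
    have B1_gt0 : 0 < b1 by apply: leq_trans (dp_b1 dp); rewrite expn_gt0 D_gt0.
    have b0j : 0 < b0 \/ b0 = 0 /\ j = 0.
      move: (dp_b0 dp); case: {+}j => [->|j' h]; [by right|left].
      by apply: leq_trans h; rewrite expn_gt0 D_gt0.
    rewrite /nd -q0; case: b0j => [b0_gt0|[b00 j0]].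
      by rewrite (sc_lay0 sc).
    have lay0 : arrs s aLay root = g0 + j.
      by rewrite -q0 (sc_lay1 sc) // b00 B1_gt0.
    rewrite q0 lay0 ltnn andbF size_cat alldone ?lay0 /=; last lia.
    have := sc_root sc; rewrite {1}j0 addn0 => /(_ erefl).
    by move: le_qt; rewrite b00 muln0 addn0; lia.
have le_pot : vsum n (potential (targets to nd) (arrs s' aDead)) <=
    vsum n (weight (targets to tn) (targets to dn) (arrs s aDead) (arrs s aLay)).
  by apply: leq_vsum => x; apply: (potential_kill x S tgE ddE').
have le_alive : alive (arrs s' aDead) + b0 <= alive (arrs s aDead).
  rewrite -[X in _ + X <= _](size_mkseq (arrs s aQue)).
  apply: count_kill ddE.
    apply/mkseq_uniqP=> i i'; rewrite !inE => hi hi'; apply: (sc_inj sc);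
      by have := dp_le dp; lia.
  move=> x; rewrite memB => hx; have [] := srch_alive S (x := x) ltac:(lia).
  by [].
have kc : kill_cost * alive (arrs s' aDead) + kill_cost * b0 <= kill_cost * alive (arrs s aDead).
  by rewrite -mulnDr leq_mul2l le_alive orbT.
have E1 : kill_cost * b0 = 43 * (Q * b0) + 10 * b0 by rewrite /kill_cost; lia.
have E2 : (3 * Q + 4) * b0 = 3 * (Q * b0) + 4 * b0 by lia.
rewrite E1 in kc; rewrite E2 in le_base; move: cr le_base0.
rewrite /round_credit /credit /round_cost; lia.
Qed.

Lemma round_ok base v nd c s :
  regs s rZ = 0 -> regs s rOne = 1 -> regs s rD = D -> regs s rQ = Q ->
  arrs s aTo = to -> regs s rV = v -> v < n -> arrs s aDead v = 0 ->
  reserve <= base -> between v nd s -> round_credit (base + round_cost) nd c s ->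
  tr round c s (fun c' s' => exists nd',
    between v.+1 nd' s' /\ round_credit base nd' c' s').
Proof.
move=> Z One RD RQ To V lt_v alive_v hbase [snd ow ls lay small].
rewrite /round_credit; set g0 := regs s rG0; set al := alive _; set pot := vsum _ _ => cr.
(* Nine instructions precede the first scan. The funds of alive vertices are held in [base1] during
   the search, since no vertex dies before [kill]. *)
pose base1 := base + round_cost + kill_cost * al - 9.
have [c' cE] := @credit_split 9 c ltac:(move: cr; rewrite /round_cost; lia).
rewrite {}cE /= in cr *.
rewrite /round; do 9 (apply: tr_seq; apply: tr_instr; rewrite /=; upd_simp).
rewrite V Z One RD -/g0; apply: tr_seq.
set s2 := set_reg _ _ _.
have root_fresh x : x <> v -> upd (arrs s aLay) v g0 x < g0.
  by move=> /eqP ne; rewrite upd_other.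
have mid2 : scan_mid E n k src to (fun x => size (nd x)) v 0 1 g0 g0 base1 0 c' s2.
  exists v, nd, (fun=> [::]), id; rewrite /s2; split=> //=; upd_simp => //.
  - split; rewrite /=; upd_simp => //.
    + exact: searching_start.
    + by move=> x; rewrite cats0; apply: ow.
    + by move=> i i' hi hi' _; lia.
    + move=> i hi; have -> : i = 0 by lia.
      by rewrite !upd_same.
    + by move=> i hi; lia.
    + move=> x; case: (eqVneq x v) => [-> _|/eqP ne]; last first.
        by move=> h; have := root_fresh x ne; rewrite ltnNge h.
      by exists 0; rewrite // upd_same.
    + by move=> x; rewrite addn0.
  - by right.
  - by move=> x; rewrite cats0; apply: ls.
  - rewrite /credit /=; upd_simp.
    have -> : vsum n (weight (targets to nd) (targets to (fun=> [::])) (arrs s aDead)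
        (upd (arrs s aLay) v g0)) = pot.
      by apply: eq_bigr => x _; rewrite /weight /potential /= !addn0.
    by rewrite /base1; move: cr; lia.
have t := @scan_layer_ok E n k E_sym E_irr E_lt E_odd src to (fun x => size (nd x)) v 0 1
  g0 g0 base1 c' s2.
have hbase1 : reserve <= base1 by rewrite /base1 /round_cost; lia.
apply: (tr_conseq (t _ _ _ _ _ mid2)); rewrite /s2.
- by split; rewrite /=; upd_simp.
- by rewrite /=; upd_simp.
- by rewrite /=; upd_simp.
- by [].
- by move: hbase1; rewrite /reserve; lia.
move=> c3 s3 [fr fa] mid3; apply: tr_seq.
apply: (tr_while (I := fun c s => deep_inv (fun x => size (nd x)) v g0 (base1 - 2) c s
   /\ alive (arrs s aDead) = al)).
  split; last by rewrite fa.
  exists 0, 0, 1, (base1 - 2); split; [|lia|by rewrite addn0].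
  by split=> //; rewrite fr //=; upd_simp; lia.
move=> c4 s4 [fr4 fa4] [dp4 al4].
have R4 : round_regs g0 s4.
  by split; rewrite ?fr4 ?fa4 // ?fr ?fa //=; upd_simp.
have hbase2 : reserve <= base1 - 2 by rewrite /base1 /round_cost; lia.
rewrite /=; case: (ltnP (regs s4 rBud) (regs s4 rQt)) => [lt_bud|ge_bud].
  have [gt0 t4] := deepen_ok R4 hbase2 lt_bud dp4; split=> //.
  apply: (tr_conseq t4) => c5 s5 [_ fa5] dp5; split=> //.
  by rewrite fa5.
have [j [b0 [b1 [b [dp le_base mid4]]]]] := dp4.
have [u [tn [dn [par [sc _ _ _ _]]]]] := mid4.
have qt_n := sc_qt_le sc; have [_ le_qt] := andP (sc_pos sc).
have hg := srch_g (sc_search sc).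
have mulb0 : (3 * Q + 4) * b0 <= (3 * Q + 4) * n.
  by rewrite leq_mul2l; have := dp_le dp; lia.
have crd := scan_mid_credit mid4.
move: (hbase2); rewrite /reserve => hbase3.
have b0_n : b0 <= n by have := dp_le dp; lia.
split; first lia.
have [Z4 One4 G04 Q4 To4] := R4.
apply: tr_seq.
apply: (tr_conseq (@kill_ok c4.-1 (c4.-1 - (5 * b0 + 2)) s4 Z4 One4 _)).
  by rewrite (dp_B0 dp); have := dp_le dp; lia.
move=> c5 s5 [fr5 fa5] [le_c5 hdE ddE].
have [c6 c5E] := @credit_split 2 c5 ltac:(lia); rewrite {}c5E /= in le_c5 *.
run.
apply: (@kill_round (fun x => size (nd x)) v g0 j b0 b1 b (base1 - 2) base c6 c4 v s4) => //=;
  upd_simp => //.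
- by rewrite -(dp_Bud dp).
- lia.
- by rewrite -(dp_B0 dp).
- by rewrite -(dp_B0 dp).
- by rewrite fa5.
- by rewrite fa5.
- by rewrite fr5.
- by rewrite fr5 // (dp_G1 dp).
- by rewrite al4 /base1; move: cr; rewrite /round_cost; lia.
Qed.

End Round.

(** * Searching from every root, then checking short lists *)

Definition search_all : prog :=
  IConst rV 0 ;;
  PWhile (TLt rV rN)
    (ILoad rL aDead rV ;; PIf (TEq rL rZ) round skip ;; ISucc rV rV).

Definition mark_all : prog :=
  ILoad rX aHead rV ;;
  PWhile (TLt rZ rX)
    ((ILoad rW aTo rX ;; IStore aMark rW rU) ;; ILoad rX aNext rX).

Definition check_list : prog :=
  ILoad rY aHead rW ;;
  PWhile (TLt rZ rY)
    ((ILoad rL aTo rY ;; ILoad rL aMark rL ;;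
      PIf (TEq rL rU) (ICopy rF rOne) skip) ;;
     ILoad rY aNext rY).

Definition check_all : prog :=
  ILoad rX aHead rV ;;
  PWhile (TLt rZ rX)
    ((ILoad rW aTo rX ;; check_list) ;; ILoad rX aNext rX).

(** The mark is [v + 1], different for each [v] and never 0, so [aMark] is not cleared between
    vertices. *)
Definition naive : prog :=
  IConst rV 0 ;;
  PWhile (TLt rV rN)
    (ISucc rU rV ;; mark_all ;; check_all ;; ISucc rV rV).

(** The rule for traversing a linked list. The invariant is indexed by the nodes visited so far, and
    the body leaves [aNext] alone, so the unvisited nodes remain a chain. *)
Lemma tr_walk x body l c s (I : seq nat -> nat -> state -> Prop)
    (Q : nat -> state -> Prop) :
  let w := PWhile (TLt rZ x) (body ;; ILoad x aNext x) in
  regs s rZ = 0 -> rZ != x -> rZ \notin wregs body -> x \notin wregs body ->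
  aNext \notin warrs body ->
  chain (arrs s aNext) (regs s x) l -> I [::] c s ->
  (forall d e r c1 s1, l = d ++ e :: r -> frame w s s1 -> regs s1 x = e ->
     I d c1 s1 -> 1 < c1 /\ tr body c1.-1 s1 (fun c2 s2 => 
       0 < c2 /\ I (rcons d e) c2.-1 (set_reg s2 x (arrs s aNext e)))) ->
  (forall c1 s1, frame w s s1 -> I l c1 s1 -> 0 < c1 /\ Q c1.-1 s1) ->
  tr w c s Q.
Proof.
move=> w Z Zx Zb xb nb ch I0 stepI lastI.
apply: (tr_while (I := fun c1 s1 => exists d r, [/\ l = d ++ r,
  chain (arrs s aNext) (regs s1 x) r & I d c1 s1])).
  by exists [::], l.
move=> c1 s1 fr [d [r [lE ch1 I1]]].
have [frr fra] := fr.
have Z1 : regs s1 rZ = 0 by rewrite frr //= mem_cat inE negb_or Zb Zx.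
have nE : arrs s1 aNext = arrs s aNext by rewrite fra //= cats0.
rewrite /= Z1; case: r lE ch1 => [|e r] lE /= ch1.
  rewrite cats0 in lE; rewrite ch1 ltnn; apply: lastI => //; by rewrite lE.
case: ch1 => xE gt ch1; rewrite xE gt.
have [ge2 t] := stepI d e r c1 s1 lE fr xE I1; split; first lia.
apply: tr_seq; apply: (tr_conseq t) => c2 s2 [fr2 fa2] [gt2 I2].
case: c2 gt2 I2 => [//|c2] _ /= I2; apply: tr_instr.
have xE2 : regs s2 x = e by rewrite fr2.
have nE2 : arrs s2 aNext = arrs s aNext by rewrite fa2.
exists (rcons d e), r; rewrite cat_rcons /= upd_same xE2 nE2; split=> //.
Qed.

Lemma mark_all_ok l c c0 s :
  regs s rZ = 0 -> chain (arrs s aNext) (arrs s aHead (regs s rV)) l ->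
  c0 + 4 * size l + 2 <= c ->
  tr mark_all c s (fun c' s' => c0 <= c' /\ forall w, arrs s' aMark w =
    if w \in map (arrs s aTo) l then regs s rU else arrs s aMark w).
Proof.
move=> Z ch le_c; have [c' cE] := @credit_split 1 c ltac:(lia).
rewrite {}cE /= in le_c *; apply: tr_seq; apply: tr_instr; rewrite /=.
set s1 := set_reg _ _ _.
apply: (@tr_walk rX _ l c' s1 (fun d c2 s2 => c0 + 4 * (size l - size d) + 1 <= c2 /\
  forall w, arrs s2 aMark w =
    if w \in map (arrs s aTo) d then regs s rU else arrs s aMark w)); rewrite //=.
- by split=> //; lia.
- move=> d e r c2 s2 lE [fr fa] xE [le_c2 mE].
  rewrite lE size_cat /= in le_c2; split; first lia.
  have [c3 c2E] := @credit_split 4 c2 ltac:(lia); rewrite {}c2E /= in le_c2 *.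
  have U2 : regs s2 rU = regs s rU by rewrite fr.
  have To2 : arrs s2 aTo = arrs s aTo by rewrite fa.
  run; rewrite U2 xE To2; split=> //; split.
    by rewrite lE size_cat size_rcons /=; lia.
  by move=> w; rewrite map_rcons mem_rcons inE /upd mE; case: eqP.
- by move=> c2 s2 _ [le_c2 mE]; split; [lia|split=> //; lia].
Qed.

Lemma check_list_ok l c c0 s :
  regs s rZ = 0 -> regs s rOne = 1 ->
  chain (arrs s aNext) (arrs s aHead (regs s rW)) l -> c0 + 6 * size l + 2 <= c ->
  tr check_list c s (fun c' s' => c0 <= c' /\ regs s' rF =
    if has (fun e => arrs s aMark (arrs s aTo e) == regs s rU) l then 1 else regs s rF).
Proof.
move=> Z One ch le_c; have [c' cE] := @credit_split 1 c ltac:(lia).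
rewrite {}cE /= in le_c *; apply: tr_seq; apply: tr_instr; rewrite /=.
set s1 := set_reg _ _ _.
apply: (@tr_walk rY _ l c' s1 (fun d c2 s2 => c0 + 6 * (size l - size d) + 1 <= c2 /\
  regs s2 rF = if has (fun e => arrs s aMark (arrs s aTo e) == regs s rU) d
    then 1 else regs s rF)); rewrite //=.
- by split=> //; lia.
- move=> d e r c2 s2 lE [fr fa] xE [le_c2 fE].
  rewrite lE size_cat /= in le_c2; split; first lia.
  have [c3 c2E] := @credit_split 6 c2 ltac:(lia); rewrite {}c2E /= in le_c2 *.
  have U2 : regs s2 rU = regs s rU by rewrite fr.
  have One2 : regs s2 rOne = 1 by rewrite fr.
  have To2 : arrs s2 aTo = arrs s aTo by rewrite fa.
  have Mk2 : arrs s2 aMark = arrs s aMark by rewrite fa.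
  run; rewrite xE To2 Mk2; apply: tr_if; rewrite /=; upd_simp; rewrite U2.
  have szE : size l - size (rcons d e) = size r.
    by rewrite lE size_cat size_rcons /=; lia.
  case: eqP => [eq_m|ne_m]; run; split=> //; rewrite szE has_rcons; (split; first lia).
    by rewrite eq_m eqxx One2.
  by rewrite fE; case: eqP.
- by move=> c2 s2 _ [le_c2 mE]; split; [lia|split=> //; lia].
Qed.

Lemma check_all_ok (nd : nat -> seq nat) D l c c0 s :
  regs s rZ = 0 -> regs s rOne = 1 ->
  chain (arrs s aNext) (arrs s aHead (regs s rV)) l ->
  (forall e, e \in l -> size (nd (arrs s aTo e)) <= D) ->
  (forall e, chain (arrs s aNext) (arrs s aHead (arrs s aTo e)) (nd (arrs s aTo e))) ->
  c0 + (6 * D + 5) * size l + 2 <= c ->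
  tr check_all c s (fun c' s' => c0 <= c' /\ regs s' rF =
    if has (fun e => has (fun e' => arrs s aMark (arrs s aTo e') == regs s rU)
       (nd (arrs s aTo e))) l then 1 else regs s rF).
Proof.
move=> Z One ch small chn le_c; have [c' cE] := @credit_split 1 c ltac:(lia).
rewrite {}cE /= in le_c *; apply: tr_seq; apply: tr_instr; rewrite /=.
set s1 := set_reg _ _ _.
set P := fun e => has _ _.
apply: (@tr_walk rX _ l c' s1 (fun d c2 s2 =>
  c0 + (6 * D + 5) * (size l - size d) + 1 <= c2 /\
  regs s2 rF = if has P d then 1 else regs s rF)); rewrite //=.
- by rewrite subn0; split=> //; lia.
- move=> d e r c2 s2 lE [fr fa] xE [le_c2 fE].
  have szE : size l - size d = (size r).+1 by rewrite lE size_cat /=; lia.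
  have szE' : size l - size (rcons d e) = size r.
    by rewrite lE size_cat size_rcons /=; lia.
  rewrite szE mulnS in le_c2; rewrite szE'; set rest := _ * size r in le_c2 *.
  split; first lia.
  have [c3 c2E] := @credit_split 2 c2 ltac:(lia); rewrite {}c2E /= in le_c2 *.
  have U2 : regs s2 rU = regs s rU by rewrite fr.
  have Z2 : regs s2 rZ = 0 by rewrite fr.
  have One2 : regs s2 rOne = 1 by rewrite fr.
  have To2 : arrs s2 aTo = arrs s aTo by rewrite fa.
  have Mk2 : arrs s2 aMark = arrs s aMark by rewrite fa.
  have Hd2 : arrs s2 aHead = arrs s aHead by rewrite fa.
  have Nx2 : arrs s2 aNext = arrs s aNext by rewrite fa.
  apply: tr_seq; apply: tr_instr; rewrite /= xE To2.
  set s3 := set_reg _ _ _.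
  have e_l : e \in l by rewrite lE mem_cat mem_head orbT.
  apply: (tr_conseq (@check_list_ok (nd (arrs s aTo e)) _ (c0 + rest + 2) s3 _ _ _ _)).
  - by [].
  - by [].
  - by rewrite /s3 /=; upd_simp; rewrite Hd2 Nx2; apply: chn.
  - by have := small e e_l; lia.
  move=> c4 s4 _ [le_c4 fE4]; split; first lia.
  rewrite /=; upd_simp; split; first lia.
  rewrite fE4 /s3 /=; upd_simp; rewrite Mk2 To2 U2 has_rcons fE /P.
  by case: has.
- by move=> c2 s2 _ [le_c2 mE]; split; [lia|split=> //; lia].
Qed.

Section Naive.

Variables (E : rel nat) (n : nat) (to : nat -> nat) (D : nat).
Hypothesis E_sym : symmetric E.
Hypothesis E_lt : forall x y, E x y -> x < n.
Hypothesis D_gt0 : 0 < D.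

Local Notation Q := (D * D).

(** Unless a triangle was found before, the lists still contain all arcs of all triangles, so the
    two-arc paths from [v] reveal every triangle through [v]. With lists of length at most [D], a
    vertex costs [O(Q)]. *)
Lemma naive_ok (nd : nat -> seq nat) c c0 s :
  regs s rZ = 0 -> regs s rOne = 1 -> regs s rN = n -> arrs s aTo = to ->
  lists (arrs s aHead) (arrs s aNext) nd ->
  (forall x, x < n -> size (nd x) <= D) ->
  sound E (targets to nd) (arrs s aDead) (regs s rF) ->
  (forall w, arrs s aMark w = 0) ->
  c0 + n * (30 * Q) + 2 <= c ->
  tr naive c s (fun c' s' => c0 <= c' /\
    (regs s' rF != 0 <-> exists x y z, triangle E x y z)).
Proof.
move=> Z One N To ls small [edge _ tri fnd] mk0 le_c.
have [c' cE] := @credit_split 1 c ltac:(lia).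
rewrite {}cE /= in le_c *; apply: tr_seq; apply: tr_instr; rewrite /=.
set s0 := set_reg _ _ _.
apply: (tr_while (I := fun c1 s1 => [/\ regs s1 rV <= n,
  forall w, arrs s1 aMark w <= regs s1 rV,
  regs s1 rF <> 0 -> exists x y z, triangle E x y z,
  regs s1 rF = 0 -> regs s rF = 0 /\
    forall x y z, x < regs s1 rV -> ~~ triangle E x y z &
  c0 + (n - regs s1 rV) * (30 * Q) + 1 <= c1])).
  rewrite /=; upd_simp; split=> //; first by move=> w; rewrite mk0.
  by rewrite subn0; lia.
move=> c1 s1 [fr fa] [le_v mk f1 f0].
have N1 : regs s1 rN = n by rewrite fr.
have Z1 : regs s1 rZ = 0 by rewrite fr.
have One1 : regs s1 rOne = 1 by rewrite fr.
have To1 : arrs s1 aTo = to by rewrite fa.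
have Hd1 : arrs s1 aHead = arrs s aHead by rewrite fa.
have Nx1 : arrs s1 aNext = arrs s aNext by rewrite fa.
rewrite /= N1; set v := regs s1 rV in le_v mk f0 *.
case: (ltnP v n) => [lt_v|ge_v] le_c1; last first.
  split; first by apply: leq_trans le_c1; rewrite addn1.
  split; first by move: le_c1; set P := _ * (30 * Q); lia.
  split=> [/eqP/f1//|[x [y [z t]]]]; apply/eqP=> /f0[_ nt].
  have lt_x : x < v by apply: leq_trans ge_v; have /andP[/E_lt] := t.
  by have := nt _ y z lt_x; rewrite t.
rewrite -(subnSK lt_v) mulSn in le_c1.
set P := (n - v.+1) * (30 * Q) in le_c1.
have D_Q : D <= Q by rewrite leq_pmull.
split; first lia.
have [c2 c1E] := @credit_split 2 c1 ltac:(lia); rewrite {}c1E /= in le_c1 *.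
apply: tr_seq; apply: tr_instr; rewrite /= -/v; apply: tr_seq.
set s2 := set_reg _ _ _.
apply: (tr_conseq (@mark_all_ok (nd v) _ (c0 + P + 6 * Q + 5 * D + 5) s2 _ _ _)).
- by rewrite /s2 /=; upd_simp.
- by rewrite /s2 /=; upd_simp; rewrite Hd1 Nx1; apply: ls.
- by have := small v lt_v; set q := Q in le_c1 D_Q *; lia.
move=> c3 s3 [fr3 fa3] [le_c3 mk3].
have V3 : regs s3 rV = v by rewrite fr3.
have U3 : regs s3 rU = v.+1 by rewrite fr3.
have To3 : arrs s3 aTo = to by rewrite fa3.
have Hd3 : arrs s3 aHead = arrs s aHead by rewrite fa3.
have Nx3 : arrs s3 aNext = arrs s aNext by rewrite fa3.
have F3 : regs s3 rF = regs s1 rF by rewrite fr3.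
(* Marks left by earlier vertices are at most [v], so only neighbours marked now carry [v.+1]. *)
have markE w : (arrs s3 aMark w == v.+1) = (w \in targets to nd v).
  rewrite mk3 /s2 /=; upd_simp; rewrite To1 /targets.
  by case: ifP => _; rewrite ?eqxx //; have := mk w; lia.
have mk3_le w : arrs s3 aMark w <= v.+1.
  rewrite mk3 /s2 /=; upd_simp; case: ifP => // _; exact: leqW.
apply: tr_seq.
apply: (tr_conseq (@check_all_ok nd D (nd v) c3 (c0 + P + 3) s3 _ _ _ _ _ _)).
- by rewrite fr3.
- by rewrite fr3.
- by rewrite V3 Hd3 Nx3; apply: ls.
- move=> e he; rewrite To3; apply: small.
  have : E v (to e) by apply: edge; apply: map_f.
  by rewrite E_sym; apply: E_lt.
- by move=> e; rewrite To3 Hd3 Nx3; apply: ls.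
- have : (6 * D + 5) * size (nd v) <= (6 * D + 5) * D by rewrite leq_mul2l small ?orbT.
  have -> : (6 * D + 5) * D = 6 * Q + 5 * D by lia.
  by set q := Q in le_c3 *; lia.
move=> c4 s4 [fr4 fa4] [le_c4 fE4].
have V4 : regs s4 rV = v by rewrite fr4.
have Mk4 : arrs s4 aMark = arrs s3 aMark by rewrite fa4.
rewrite To3 U3 F3 in fE4.
have [c5 c4E] := @credit_split 1 c4 ltac:(lia); rewrite {}c4E /= in le_c4 *.
apply: tr_instr; rewrite /=; upd_simp; rewrite V4 Mk4; split=> //.
- rewrite fE4; case: hasP => [[e he /hasP[e' he' m]] _|_]; last exact: f1.
  rewrite markE in m; exists v, (to e), (to e').
  rewrite /triangle (E_sym (to e')) !edge //; exact: map_f.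
- rewrite fE4; case: hasP => [//|no_e] /f0[F0 nt]; split=> // x y z.
  rewrite ltnS leq_eqVlt => /orP[/eqP->|]; last exact: nt.
  apply/negP=> t; apply: no_e.
  have [/mapP[e he yE] _] := tri F0 _ _ _ t.
  have [/mapP[e' he' zE] _] := tri F0 _ _ _ (triangle_rot t).
  have [zv _] := tri F0 _ _ _ (triangle_flip E_sym (triangle_rot (triangle_rot t))).
  exists e => //; apply/hasP; exists e'; rewrite -?yE // -zE markE //.
- by rewrite -/P; lia.
Qed.

End Naive.

Section SearchAll.

Variables (E : rel nat) (n k : nat).
Hypothesis E_sym : symmetric E.
Hypothesis E_irr : irreflexive E.
Hypothesis E_lt : forall x y, E x y -> x < n.
Hypothesis E_odd : forall l c, 2 <= l <= k -> size c = 2 * l + 1 -> uniq c ->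
  ~~ cycle E c.
Hypothesis k_gt0 : 0 < k.

Variables (src to : nat -> nat) (D : nat).
Hypothesis D_gt0 : 0 < D.
Hypothesis D_pow : n <= D ^ k.

Local Notation A := 20.
Local Notation Q := (D * D).

Lemma search_all_ok base nd c s :
  regs s rZ = 0 -> regs s rOne = 1 -> regs s rD = D -> regs s rQ = Q ->
  regs s rN = n -> arrs s aTo = to ->
  reserve n k D <= base -> between E src to D 0 nd s ->
  round_credit n to D (base + n * (round_cost k D + 10) + 10) nd c s ->
  tr search_all c s (fun c' s' => exists nd',
    between E src to D n nd' s' /\ base <= c').
Proof.
move=> Z One RD RQ N To hbase bw cr.
have [c' cE] := @credit_split 5 c ltac:(have := round_credit_ge cr; lia).
rewrite {}cE /= in cr *; apply: tr_seq; apply: tr_instr; rewrite /=.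
apply: (tr_while (I := fun c1 s1 => regs s1 rV <= n /\ exists nd1,
  between E src to D (regs s1 rV) nd1 s1 /\
  round_credit n to D (base + (n - regs s1 rV) * (round_cost k D + 10) + 5) nd1 c1 s1)).
  rewrite /=; upd_simp; split=> //; exists nd; split.
    by case: bw => b1 b2 b3 b4 _; split; rewrite /=; upd_simp.
  by rewrite subn0; apply: (round_credit_frame cr) => //=; lia.
move=> c1 s1 [fr fa] [le_v [nd1 [bw1 cr1]]].
have N1 : regs s1 rN = n by rewrite fr //=; upd_simp.
have Z1 : regs s1 rZ = 0 by rewrite fr //=; upd_simp.
have One1 : regs s1 rOne = 1 by rewrite fr //=; upd_simp.
have D1 : regs s1 rD = D by rewrite fr //=; upd_simp.
have Q1 : regs s1 rQ = Q by rewrite fr //=; upd_simp.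
have To1 : arrs s1 aTo = to by rewrite fa //=; upd_simp.
have := round_credit_ge cr1; set v := regs s1 rV in le_v bw1 cr1 *.
rewrite /= N1 -/v; case: (ltnP v n) => [lt_v|ge_v]; last first.
  set P := _ * _ => ge_c1; split; first lia.
  by exists nd1; split; [have -> : n = v by lia|lia].
have mE : (n - v) * (round_cost k D + 10) =
    (n - v.+1) * (round_cost k D + 10) + (round_cost k D + 10).
  by rewrite -mulSnr subnSK.
rewrite {}mE in cr1 *; set P := (n - v.+1) * _ in cr1 * => ge_c1.
split; first lia.
have [c2 c1E] := @credit_split 5 c1 ltac:(lia).
rewrite {}c1E /= in cr1 ge_c1 *.
apply: tr_seq; apply: tr_instr; rewrite /=; apply: tr_seq; apply: tr_if.
rewrite /=; upd_simp; rewrite Z1 -/v; case: eqP => [alive_v|dead_v].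
  have t := @round_ok E n k E_sym E_irr E_lt E_odd k_gt0 src to D D_gt0 D_pow (base + P + 8) v nd1.
  apply: (tr_conseq (t _ _ _ _ _ _ _ _ _ _ _ _ _)); rewrite /=; upd_simp => //.
  - by lia.
  - by case: bw1 => b1 b2 b3 b4 b5; split; rewrite /=; upd_simp.
  - by apply: (round_credit_frame cr1) => //=; lia.
  move=> c3 s3 [fr3 fa3] [nd3 [bw3 cr3]].
  have vE : regs s3 rV = v by rewrite fr3 //=; upd_simp.
  have [c4 c3E] := @credit_split 1 c3 ltac:(have := round_credit_ge cr3; lia).
  rewrite {}c3E /= in cr3 *.
  apply: tr_instr; rewrite /=; upd_simp; rewrite vE; split=> //; exists nd3; split.
    by case: bw3 => b1 b2 b3 b4 b5; split; rewrite /=; upd_simp.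
  by apply: (round_credit_frame cr3) => //=; lia.
(* A dead vertex has an empty list, so it needs no search to satisfy the degree bound. *)
run; split=> //; exists nd1; split.
  case: bw1 => b1 b2 b3 b4 b5; split; rewrite /=; upd_simp => //.
  move=> x; rewrite ltnS leq_eqVlt => /orP[/eqP->|/b5//].
  by have /(congr1 size) := sound_dead b1 dead_v; rewrite /targets size_map => ->.
by apply: (round_credit_frame cr1) => //=; lia.
Qed.

End SearchAll.

(** * Building the lists and choosing the degree bound *)

Definition push (a b : nat) : prog :=
  ISucc rX rX ;; IStore aTo rX b ;; ILoad rL aHead a ;; IStore aNext rX rL ;;
  IStore aHead a rX.

Definition build : prog :=
  IConst rV 0 ;; IConst rX 0 ;;
  PWhile (TLt rV rM)
    (ILoad rU 0 rV ;; ILoad rW 1 rV ;; push rU rW ;; push rW rU ;; ISucc rV rV).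

Definition built (hd nx to : nat -> nat) (x : nat) (lst : nat -> seq nat) :=
  exists src nd, [/\ owned src nd, lists hd nx nd,
    forall y e, e \in nd y -> e <= x & forall y, targets to nd y = lst y].

(** Nodes are allocated in increasing order, so [x.+1] occurs in no list and the updates at it
    disturb nothing. *)
Lemma built_push hd nx to x lst a b : built hd nx to x lst ->
  built (upd hd a x.+1) (upd nx x.+1 (hd a)) (upd to x.+1 b) x.+1
    (upd lst a (b :: lst a)).
Proof.
move=> [src [nd [ow ls bnd tg]]].
have fresh y : x.+1 \notin nd y by apply/negP=> /bnd; lia.
have srcE y e : e \in nd y -> upd src x.+1 a e = y.
  move=> he; rewrite upd_other; last by have := bnd _ _ he; lia.
  exact: (ow y).2.
have tgE y : [seq upd to x.+1 b e | e <- nd y] = lst y.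
  rewrite -tg; apply/eq_in_map => e he.
  by rewrite upd_other //; have := bnd _ _ he; lia.
exists (upd src x.+1 a), (upd nd a (x.+1 :: nd a)); split.
- move=> y; case: (eqVneq y a) => [->|ne]; last first.
    by rewrite upd_other //; split; [exact: (ow y).1|exact: srcE].
  rewrite upd_same; split; first by rewrite /= fresh; exact: (ow a).1.
  by move=> e; rewrite inE => /orP[/eqP->|/srcE//]; rewrite upd_same.
- move=> y; case: (eqVneq y a) => [->|ne]; last first.
    by rewrite !upd_other //; apply: chain_upd.
  by rewrite !upd_same /=; split=> //; rewrite upd_same; apply: chain_upd.
- move=> y e; case: (eqVneq y a) => [->|ne]; last by rewrite upd_other // => /bnd; lia.
  by rewrite upd_same inE => /orP[/eqP->//|/bnd]; lia.
- move=> y; rewrite /targets; case: (eqVneq y a) => [->|ne]; last by rewrite !upd_other.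
  by rewrite !upd_same /= tgE upd_same.
Qed.

Definition mul_step : prog :=
  IConst rQt 0 ;; IConst rCp 0 ;; add_mul rQt rPos rD rCp rL ;; ICopy rPos rQt.

Lemma mul_step_ok c c0 s :
  c0 + (3 * regs s rD + 4) * regs s rPos + 4 <= c ->
  tr mul_step c s (fun c' s' =>
    c0 <= c' /\ regs s' rPos = regs s rD * regs s rPos).
Proof.
set P := _ * regs s rPos => le_c.
have [c' cE] := @credit_split 2 c ltac:(lia); rewrite {}cE /= in le_c *.
run; set s1 := set_reg _ _ _.
apply: (tr_conseq (@add_mul_ok rQt rPos rD rCp rL _ (c0 + 1) s1 isT _ _));
  rewrite /s1 /=; upd_simp => //.
  by rewrite subn0 -/P; lia.
move=> c2 s2 [fr _]; rewrite subn0 add0n => -[le_c2 _ qE].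
have [c3 c2E] := @credit_split 1 c2 ltac:(lia); rewrite {}c2E /= in le_c2 *.
by apply: tr_instr; rewrite /=; upd_simp; split=> //; lia.
Qed.

(** The exponent is a constant of the algorithm, so the power is unrolled into straight-line
    multiplications. *)
Fixpoint mul_steps (j : nat) : prog :=
  if j is j'.+1 then mul_step ;; mul_steps j' else skip.

Lemma wregs_mul_steps j r :
  r \notin [:: rQt; rCp; rPos; rL] -> r \notin wregs (mul_steps j).
Proof.
rewrite !inE !negb_or => /and4P[h1 h2 h3 h4].
elim: j => [|j IHj]; first by rewrite inE.
by rewrite /= !inE (negbTE h1) (negbTE h2) (negbTE h3) (negbTE h4).
Qed.

Lemma warrs_mul_steps j : warrs (mul_steps j) = [::].
Proof. by elim: j. Qed.

(** [M] bounds all intermediate powers, so every multiplication is charged as the most expensive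
    one. *)
Lemma mul_steps_ok j M c c0 s : 0 < regs s rD ->
  regs s rPos * regs s rD ^ j <= M ->
  c0 + j * ((3 * regs s rD + 4) * M + 4) + 1 <= c ->
  tr (mul_steps j) c s (fun c' s' =>
    c0 <= c' /\ regs s' rPos = regs s rPos * regs s rD ^ j).
Proof.
elim: j c s => [|j IHj] c s D_gt0 le_M le_c.
  have [c' cE] := @credit_split 1 c ltac:(lia); rewrite {}cE /= in le_c *.
  by apply: tr_instr; rewrite /=; upd_simp; rewrite expn0 muln1; split=> //; lia.
have le_P : (3 * regs s rD + 4) * regs s rPos <= (3 * regs s rD + 4) * M.
  by rewrite leq_mul2l (leq_trans _ le_M) ?orbT // leq_pmulr // expn_gt0 D_gt0.
rewrite mulSn in le_c; apply: tr_seq.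
set P := j * _ in le_c.
apply: (tr_conseq (@mul_step_ok c (c0 + P + 1) s _)); first lia.
move=> c1 s1 [fr _] [le_c1 pE].
have DE : regs s1 rD = regs s rD by rewrite fr.
apply: (tr_conseq (IHj c1 s1 _ _ _)); rewrite ?DE ?pE //.
  by rewrite -mulnA mulnCA -expnS.
by move=> c2 s2 _ [le_c2 ->]; rewrite expnS [RHS]mulnCA [RHS]mulnA.
Qed.

(** Candidates are tried upwards from 1, where the power is 1. One candidate costs
    [O(k * D * D ^ k)], so with [D ^ k = O(n)] all of them fit into [O(n * D ^ 2)]. *)
Definition root_prog (k : nat) : prog :=
  IConst rD 1 ;; IConst rPos 1 ;;
  PWhile (TLt rPos rN) (ISucc rD rD ;; IConst rPos 1 ;; mul_steps k).

Definition root_cost (k D : nat) := k * ((3 * D + 4) * D ^ k + 4) + 5.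

Lemma root_prog_ok k D c c0 s : 0 < D -> regs s rN <= D ^ k ->
  (forall d, 0 < d -> regs s rN <= d ^ k -> D <= d) ->
  c0 + D * root_cost k D + 3 <= c ->
  tr (root_prog k) c s (fun c' s' => c0 <= c' /\ regs s' rD = D).
Proof.
move=> D_gt0 D_pow D_min le_c.
have [c' cE] := @credit_split 2 c ltac:(lia); rewrite {}cE /= in le_c *.
run; set s1 := set_reg _ _ _.
have keep r : r \notin [:: rD; rQt; rCp; rPos; rL] ->
    r \notin wregs (ISucc rD rD ;; IConst rPos 1 ;; mul_steps k).
  rewrite !inE !negb_or => /and5P[h1 h2 h3 h4 h5] /=.
  rewrite h1 h4; apply: (@wregs_mul_steps k r).
  by rewrite !inE !negb_or h2 h3 h4 h5.
apply: (tr_while (I := fun c1 s1 => [/\ 0 < regs s1 rD <= D,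
  regs s1 rPos = regs s1 rD ^ k & c0 + (D - regs s1 rD) * root_cost k D + 1 <= c1])).
  rewrite /s1 /=; upd_simp; rewrite exp1n; split=> //.
  have : (D - 1) * root_cost k D <= D * root_cost k D by rewrite leq_mul2r leq_subr orbT.
  by lia.
move=> c1 s2 [fr _] [hD pE le_c1].
have N2 : regs s2 rN = regs s rN by rewrite fr ?keep // /s1 /=; upd_simp.
split; first by apply: leq_trans le_c1; rewrite addn1.
rewrite /= N2 pE; case: ltnP => [lt_p|ge_p]; last first.
  have DE : regs s2 rD = D by have := D_min _ _ ge_p; lia.
  by split=> //; move: le_c1; set P := _ * root_cost _ _; lia.
have lt_D : regs s2 rD < D.
  rewrite ltn_neqAle; have /andP[_ ->] := hD; rewrite andbT.
  by apply/eqP=> e; move: lt_p; rewrite e ltnNge D_pow.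
rewrite -(subnSK lt_D) mulSn in le_c1; set P := _ * root_cost _ _ in le_c1.
have hc : root_cost k D >= 5 by rewrite /root_cost; lia.
have [c2 c1E] := @credit_split 3 c1 ltac:(lia); rewrite {}c1E /= in le_c1 *.
apply: tr_seq; apply: tr_instr; rewrite /=; apply: tr_seq; apply: tr_instr; rewrite /=.
set s3 := set_reg _ _ _.
have D3 : regs s3 rD = (regs s2 rD).+1 by rewrite /s3 /=; upd_simp.
have P3 : regs s3 rPos = 1 by rewrite /s3 /=; upd_simp.
apply: (tr_conseq (@mul_steps_ok k (D ^ k) _ (c0 + P + 1) s3 _ _ _)).
- by rewrite D3.
- rewrite P3 mul1n D3.
  by case: (posnP k) => [->|k_gt0]; rewrite ?expn0 ?leq_exp2r.
- rewrite D3; move: le_c1; rewrite /root_cost.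
  have : k * ((3 * (regs s2 rD).+1 + 4) * D ^ k + 4) <= k * ((3 * D + 4) * D ^ k + 4).
    by rewrite leq_mul2l leq_add2r leq_mul2r leq_add2r leq_mul2l lt_D !orbT.
  by set u1 := k * _; set u2 := k * _; lia.
move=> c4 s4 [fr4 _] [le_c4 pE4].
have D4 : regs s4 rD = (regs s2 rD).+1.
  by rewrite fr4 ?D3 //; apply: wregs_mul_steps.
by rewrite D4 pE4 P3 mul1n D3; split.
Qed.

(** An edge takes 14 steps: the test, two loads, two pushes of five instructions each, and the
    increment. *)
Lemma build_ok (E : rel nat) n m c c0 s :
  regs s rM = m -> regs s rZ = 0 -> 
  (forall x y, E x y -> x < n) -> symmetric E ->
  (forall a x, 1 < a -> arrs s a x = 0) ->
  (forall i, i < m -> E (arrs s 0 i) (arrs s 1 i)) ->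
  c0 + 14 * m + 3 <= c ->
  tr build c s (fun c' s' => c0 <= c' /\ exists lst,
    [/\ built (arrs s' aHead) (arrs s' aNext) (arrs s' aTo) (regs s' rX) lst,
        forall x y, y \in lst x -> E x y,
        forall i, i < m -> arrs s 1 i \in lst (arrs s 0 i) /\
                           arrs s 0 i \in lst (arrs s 1 i) &
        vsum n (fun x => size (lst x)) <= 2 * m]).
Proof.
move=> M Z E_lt E_sym arr0 edgeE le_c.
have [c' cE] := @credit_split 2 c ltac:(lia); rewrite {}cE /= in le_c *.
run; set s1 := set_reg _ _ _.
apply: (tr_while (I := fun c1 s2 => [/\ regs s2 rV <= m,
  c0 + 14 * (m - regs s2 rV) + 1 <= c1 & exists lst,
    [/\ built (arrs s2 aHead) (arrs s2 aNext) (arrs s2 aTo) (regs s2 rX) lst,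
        forall x y, y \in lst x -> E x y,
        forall i, i < regs s2 rV -> arrs s 1 i \in lst (arrs s 0 i) /\
                           arrs s 0 i \in lst (arrs s 1 i) &
        vsum n (fun x => size (lst x)) <= 2 * regs s2 rV]])).
  rewrite /s1 /=; upd_simp; split=> //; first lia.
  exists (fun=> [::]); split=> //; last by rewrite /vsum big1.
  by exists id, (fun=> [::]); split=> // x /=; rewrite arr0.
move=> c1 s2 [fr fa] [le_v le_c1 [lst [bl ed all sz]]].
have M2 : regs s2 rM = m by rewrite fr.
have A0 : arrs s2 0 = arrs s 0 by rewrite fa.
have A1 : arrs s2 1 = arrs s 1 by rewrite fa.
split; first lia.
rewrite /= M2; case: ltnP => [lt_v|ge_v]; last first.
  have vE : regs s2 rV = m by lia.
  by rewrite vE in all sz; split; [lia|exists lst].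
set v := regs s2 rV in le_v le_c1 all sz lt_v *.
set a := arrs s 0 v; set b := arrs s 1 v.
have Eab : E a b by apply: edgeE.
have [c2 c1E] := @credit_split 14 c1 ltac:(lia); rewrite {}c1E /= in le_c1 *.
have bl1 := built_push a b bl.
have bl2 := built_push b a bl1.
run; rewrite A0 A1 -/v -/a -/b; split=> //; first lia.
pose lst1 := upd lst a (b :: lst a); pose lst2 := upd lst1 b (a :: lst1 b).
have sub1 x y : y \in lst x -> y \in lst1 x.
  rewrite /lst1; case: (eqVneq x a) => [->|ne]; last by rewrite upd_other.
  by rewrite upd_same inE => ->; rewrite orbT.
have sub2 x y : y \in lst1 x -> y \in lst2 x.
  rewrite /lst2; case: (eqVneq x b) => [->|ne]; last by rewrite upd_other.
  by rewrite upd_same inE => ->; rewrite orbT.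
exists lst2; split=> //.
- have ed1 x y : y \in lst1 x -> E x y.
    rewrite /lst1; case: (eqVneq x a) => [->|ne]; last by rewrite upd_other //; apply: ed.
    by rewrite upd_same inE => /orP[/eqP->|/ed].
  move=> x y; rewrite /lst2; case: (eqVneq x b) => [->|ne].
    by rewrite upd_same inE => /orP[/eqP->|/ed1//]; rewrite E_sym.
  by rewrite upd_other //; apply: ed1.
- move=> i; rewrite ltnS leq_eqVlt => /orP[/eqP->|/all[h1 h2]].
    split; last by rewrite /lst2 upd_same mem_head.
    by apply: sub2; rewrite /lst1 upd_same mem_head.
  by split; apply: sub2; apply: sub1.
- have lt_a := E_lt _ _ Eab; have lt_b : b < n by move: Eab; rewrite E_sym; apply: E_lt.
  have v1 := @vsum_at n (fun x => size (lst x)) (fun x => size (lst1 x)) a lt_a.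
  have v2 := @vsum_at n (fun x => size (lst1 x)) (fun x => size (lst2 x)) b lt_b.
  have {}v1 := v1 (fun x ne => congr1 size (upd_other lst _ (introN eqP ne))).
  have {}v2 := v2 (fun x ne => congr1 size (upd_other lst1 _ (introN eqP ne))).
  move: v1 v2; rewrite {2}/lst1 {2}/lst2 !upd_same /=; lia.
Qed.

(** * The whole algorithm and its running time *)

Definition find_triangle (k : nat) : prog :=
  IConst rOne 1 ;; build ;; root_prog k ;;
  IConst rQ 0 ;; IConst rCp 0 ;; ICopy rPos rD ;; add_mul rQ rPos rD rCp rL ;;
  ICopy rG0 rOne ;; search_all ;; naive ;; ICopy rN rF.

Definition search_cost (n k D : nat) :=
  reserve n k D + n * (30 * (D * D)) + 3 + n * (round_cost k D + 10) + 10
    + kill_cost D * n.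

(** In order: building the lists, finding [D], squaring it, the credits on the arcs (two arcs per
    edge, each worth at most 2 units of 20 steps), then the searches with the final check. *)
Definition total_cost (n m k D : nat) :=
  14 * m + 3 + (D * root_cost k D + 3) + ((3 * D + 4) * D + 1) +
  (20 * (4 * m) + search_cost n k D) + 20.

Lemma find_triangle_ok (E : rel nat) n m k D s :
  (forall x y, E x y -> x < n) -> symmetric E -> irreflexive E ->
  (forall l c, 2 <= l <= k -> size c = 2 * l + 1 -> uniq c -> ~~ cycle E c) ->
  0 < k -> 0 < D -> n <= D ^ k -> (forall d, 0 < d -> n <= d ^ k -> D <= d) ->
  regs s rN = n -> regs s rM = m -> (forall r, 1 < r -> regs s r = 0) ->
  (forall a x, 1 < a -> arrs s a x = 0) ->
  (forall i, i < m -> E (arrs s 0 i) (arrs s 1 i)) ->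
  (forall x y, E x y -> exists2 i, i < m &
     (x, y) = (arrs s 0 i, arrs s 1 i) \/ (y, x) = (arrs s 0 i, arrs s 1 i)) ->
  tr (find_triangle k) (total_cost n m k D) s (fun _ s' =>
    regs s' rN != 0 <-> exists x y z, triangle E x y z).
Proof.
move=> E_lt E_sym E_irr E_odd k_gt0 D_gt0 D_pow D_min N M reg0 arr0 edge edgeE.
rewrite /total_cost.
have [c1 cE] := @credit_split 1 (total_cost n m k D) ltac:(rewrite /total_cost; lia).
have {}cE : 14 * m + 3 + (D * root_cost k D + 3) + ((3 * D + 4) * D + 1) +
  (20 * (4 * m) + search_cost n k D) + 20 = c1.+1 by rewrite -[RHS]cE.
rewrite cE; apply: tr_seq; apply: tr_instr; apply: tr_seq; rewrite /=.
set s1 := set_reg _ _ _.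
set X2 := D * root_cost k D in cE; set X3 := (3 * D + 4) * D in cE.
set X4 := search_cost n k D in cE.
apply: (tr_conseq (@build_ok E n m c1 (X2 + 3 + (X3 + 1) + (80 * m + X4) + 19) s1
  _ _ E_lt E_sym _ _ _)).
- by rewrite /s1 /=; upd_simp.
- by rewrite /s1 /=; upd_simp; apply: reg0.
- by move=> a x; apply: arr0.
- by move=> i; apply: edge.
- lia.
move=> c2 s2 [fr2 fa2] [le_c2 [lst [[src [nd [ow ls _ tg]]] ed all sz]]].
apply: tr_seq.
have N2 : regs s2 rN = n by rewrite fr2 // /s1 /=; upd_simp.
apply: (tr_conseq (@root_prog_ok k D c2 (X3 + 1 + (80 * m + X4) + 19) s2 D_gt0 _ _ _)).
- by rewrite N2.
- by rewrite N2.
- by rewrite -/X2; lia.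
move=> c3 s3 [fr3 fa3] [le_c3 D3].
have k3 r : r \notin [:: rD; rQt; rCp; rPos; rL] -> regs s3 r = regs s2 r.
  rewrite !inE !negb_or => /and5P[h1 h2 h3 h4 h5]; apply: fr3.
  rewrite /= !inE !negb_or h1 h4; apply: (@wregs_mul_steps k r).
  by rewrite !inE !negb_or h2 h3 h4 h5.
have a3 a : arrs s3 a = arrs s2 a by apply: fa3; rewrite /= warrs_mul_steps.
have [c4 c3E] := @credit_split 3 c3 ltac:(lia); rewrite {}c3E /= in le_c3 *.
do 3 (apply: tr_seq; apply: tr_instr; rewrite /=; upd_simp); rewrite D3.
apply: tr_seq; set s4 := set_reg _ _ _.
have D4 : regs s4 rD = D by rewrite /s4 /=; upd_simp.
have Pos4 : regs s4 rPos = D by rewrite /s4 /=; upd_simp.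
have Cp4 : regs s4 rCp = 0 by rewrite /s4 /=; upd_simp.
have Q4 : regs s4 rQ = 0 by rewrite /s4 /=; upd_simp.
apply: (tr_conseq (@add_mul_ok rQ rPos rD rCp rL c4 (80 * m + X4 + 16) s4 isT _ _)).
- by rewrite Cp4.
- by rewrite D4 Pos4 Cp4 subn0 -/X3; lia.
move=> c5 s5 [fr5 fa5] [le_c5 _ Q5]; rewrite Q4 D4 Pos4 Cp4 subn0 add0n in Q5.
have One5 : regs s5 rOne = 1.
  by rewrite fr5 // /s4 /=; upd_simp; rewrite k3 // fr2 // /s1 /=; upd_simp.
have Z5 : regs s5 rZ = 0.
  by rewrite fr5 // /s4 /=; upd_simp; rewrite k3 // fr2 // /s1 /=; upd_simp; apply: reg0.
have F5 : regs s5 rF = 0.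
  by rewrite fr5 // /s4 /=; upd_simp; rewrite k3 // fr2 // /s1 /=; upd_simp; apply: reg0.
have N5 : regs s5 rN = n.
  by rewrite fr5 // /s4 /=; upd_simp; rewrite k3.
have D5 : regs s5 rD = D by rewrite fr5.
have a5 a : arrs s5 a = arrs s2 a by rewrite fa5 // /s4 /= a3.
have dead5 x : arrs s5 aDead x = 0 by rewrite a5 fa2 //; apply: arr0.
have lay5 x : arrs s5 aLay x = 0 by rewrite a5 fa2 //; apply: arr0.
have mark5 x : arrs s5 aMark x = 0 by rewrite a5 fa2 //; apply: arr0.
have [c6 c5E] := @credit_split 1 c5 ltac:(lia); rewrite {}c5E /= in le_c5 *.
apply: tr_seq; apply: tr_instr; rewrite /= One5; apply: tr_seq.
set s6 := set_reg _ _ _.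
have bw : between E src (arrs s2 aTo) D 0 nd s6.
  split; rewrite /s6 /=; upd_simp => //.
  - split=> [x y|x|_ x y z /and3P[xy _ _]|//]; last first.
    + split=> //; rewrite tg; have [i lt_i] := edgeE _ _ xy.
      by have [h1 h2] := all _ lt_i => -[[-> ->]|[-> ->]].
    + by rewrite dead5.
    + by rewrite tg; apply: ed.
  - by rewrite !a5.
  - by move=> x; rewrite lay5.
have le_alive : kill_cost D * alive n (arrs s6 aDead) <= kill_cost D * n.
  rewrite leq_mul2l /alive; apply/orP; right.
  by rewrite -[X in _ <= X](size_iota 0 n) count_size.
have le_pot : vsum n (potential (targets (arrs s2 aTo) nd) (arrs s6 aDead)) <= 4 * m.
  have -> : 4 * m = 2 * (2 * m) by lia.
  apply: leq_trans (leq_mul (leqnn 2) sz); rewrite /vsum big_distrr /=.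
  apply: leq_sum => x _; rewrite /potential tg mul2n -addnn leq_add2l.
  exact: count_size.
pose base := reserve n k D + n * (30 * (D * D)) + 3.
have t := @search_all_ok E n k E_sym E_irr E_lt E_odd k_gt0 src (arrs s2 aTo) D D_gt0
  D_pow base nd c6 s6.
apply: (tr_conseq (t _ _ _ _ _ _ _ bw _)); rewrite /s6 /=; upd_simp => //.
- by rewrite /base -addnA leq_addr.
- rewrite /round_credit /=; move: le_c5 le_alive le_pot; rewrite /X4 /search_cost -/base.
  rewrite /s6 /=; set a1 := kill_cost D * alive _ _; set a2 := kill_cost D * n.
  by set a3' := n * (round_cost k D + 10); lia.
move=> c7 s7 [fr7 fa7] [nd7 [[snd7 _ ls7 _ small7] le_c7]].
apply: tr_seq.
apply: (tr_conseq (@naive_ok E n (arrs s2 aTo) D E_sym E_lt D_gt0 nd7 c7 1 s7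
  _ _ _ _ ls7 small7 snd7 _ _)).
- by rewrite fr7 //=; upd_simp.
- by rewrite fr7 //=; upd_simp.
- by rewrite fr7 //=; upd_simp.
- by rewrite fa7 //= a5.
- by move=> x; rewrite fa7 //; apply: mark5.
- by move: le_c7; rewrite /base; set a1 := n * _; lia.
move=> c8 s8 _ [gt0 eq_F]; case: c8 gt0 => // c8 _.
by apply: tr_instr; rewrite /=; upd_simp.
Qed.

(** Apart from the terms in [m], everything is compared with [N = n * D ^ 2]; the hypothesis on
    [D ^ k] bounds the computation of [D]. *)
Lemma total_cost_le n m k D : 0 < n -> 0 < k -> 0 < D -> D ^ k <= 2 ^ k * n ->
  total_cost n m k D <= (11 * k * 2 ^ k + 20 * k + 1000) * (m + n * (D * D)).
Proof.
move=> n_gt0 k_gt0 D_gt0 le_pow; pose N := n * (D * D).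
have le_Q : D * D <= N by rewrite /N leq_pmull.
have le_n : n <= N by rewrite /N leq_pmulr // muln_gt0 D_gt0.
have le_D : D <= D * D by rewrite leq_pmull.
have N_gt0 : 0 < N by lia.
have le_nD : n * D <= N by rewrite /N leq_mul2l le_D orbT.
have kN : k * n <= k * N by rewrite leq_mul2l le_n orbT.
have kN1 : k <= k * N by rewrite leq_pmulr.
have root_le : D * root_cost k D <= 11 * (k * 2 ^ k * N) + 5 * N.
  rewrite /root_cost mulnDr mulnCA.
  have h1 : (3 * D + 4) * D ^ k <= 7 * D * (2 ^ k * n).
    by apply: leq_mul => //; lia.
  have h2 : D * ((3 * D + 4) * D ^ k + 4) <= 11 * (2 ^ k * N).
    have : D * ((3 * D + 4) * D ^ k) <= D * (7 * D * (2 ^ k * n)).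
      by rewrite leq_mul2l h1 orbT.
    have -> : D * (7 * D * (2 ^ k * n)) = 7 * (2 ^ k * N) by rewrite /N; lia.
    have : N <= 2 ^ k * N by rewrite leq_pmull ?expn_gt0.
    by lia.
  have : k * (D * ((3 * D + 4) * D ^ k + 4)) <= k * (11 * (2 ^ k * N)).
    by rewrite leq_mul2l h2 orbT.
  by lia.
rewrite /total_cost /search_cost /reserve /round_cost /kill_cost.
have -> : (11 * k * 2 ^ k + 20 * k + 1000) * (m + n * (D * D)) =
  (11 * k * 2 ^ k + 20 * k + 1000) * m + (11 * (k * 2 ^ k * N) + 20 * (k * N) + 1000 * N).
  by rewrite -/N; lia.
have : 1000 * m <= (11 * k * 2 ^ k + 20 * k + 1000) * m by rewrite leq_mul2r; lia.
have nN : n * (D * D) = N by [].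
move: root_le; set R := D * root_cost k D; set W := k * 2 ^ k * N.
set U := (_ + 1000) * m.
lia.
Qed.

Import Order.TTheory GRing.Theory Num.Theory.

(** * From graphs to relations on natural numbers *)

(** The machine stores vertices as bare numbers; numbers from [n] on become isolated vertices. *)
Definition nat_adj n (G : sgraph n) : rel nat := fun x y =>
  if insub x is Some i then if insub y is Some j then adj G i j else false
  else false.

Lemma nat_adj_val n (G : sgraph n) (i j : 'I_n) : nat_adj G i j = adj G i j.
Proof. by rewrite /nat_adj !valK. Qed.

Lemma nat_adjP n (G : sgraph n) x y : nat_adj G x y ->
  exists i j : 'I_n, [/\ x = i, y = j & adj G i j].
Proof.
rewrite /nat_adj; case: insubP => [i _ <-|//]; case: insubP => [j _ <-|//] ij.
by exists i, j.
Qed.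

Lemma nat_adj_sym n (G : sgraph n) : symmetric (nat_adj G).
Proof.
by move=> x y; apply/idP/idP => /nat_adjP[i [j [-> -> ij]]];
  rewrite nat_adj_val adj_sym.
Qed.

Lemma nat_adj_irr n (G : sgraph n) : irreflexive (nat_adj G).
Proof.
move=> x; apply/negP=> /nat_adjP[i [j [-> /val_inj->]]].
by rewrite adj_irrefl.
Qed.

Lemma nat_adj_lt n (G : sgraph n) x y : nat_adj G x y -> x < n.
Proof. by move=> /nat_adjP[i [j [-> _ _]]]. Qed.

Lemma all_ltn_map_val n c : all (fun x => x < n) c ->
  exists c' : seq 'I_n, c = map val c'.
Proof.
elim: c => [|x c IHc] /=; first by exists [::].
by move=> /andP[lt_x /IHc[c' ->]]; exists (Ordinal lt_x :: c').
Qed.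

Lemma nat_cycle n (G : sgraph n) c : uniq c -> cycle (nat_adj G) c ->
  has_cycle G (size c).
Proof.
move=> un cyc; have [|c' cE] := @all_ltn_map_val n c.
  (* Every vertex of a cycle has a successor on it, hence is an end point of an edge. *)
  by apply/allP=> x /(next_cycle cyc)/nat_adj_lt.
exists c'; rewrite cE size_map; split=> //.
  by rewrite cE (map_inj_uniq val_inj) in un.
by rewrite cE (mono_cycle (nat_adj_val G)) in cyc.
Qed.

Lemma nat_triangle n (G : sgraph n) :
  has_triangle G <-> exists x y z, triangle (nat_adj G) x y z.
Proof.
split=> [[[|x [|y [|z [|? ?]]]] [//= _ _]]|[x [y [z]]]].
  by rewrite andbT => xyz; exists x, y, z; rewrite /triangle !nat_adj_val.
move=> t; have := t; case/and3P=> xy yz zx.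
apply: (@nat_cycle n G [:: x; y; z]); last by rewrite /= andbT.
have neq a b : nat_adj G a b -> a != b.
  by move=> ab; apply/eqP=> e; rewrite e nat_adj_irr in ab.
by rewrite /= !inE negb_or (neq _ _ xy) (neq _ _ yz) eq_sym (neq _ _ zx).
Qed.

Lemma eq_set2 (T : finType) (a b c d : T) : [set a; b] = [set c; d] ->
  (a, b) = (c, d) \/ (b, a) = (c, d).
Proof.
move=> eq_set.
have /set2P ha : a \in [set c; d] by rewrite -eq_set set21.
have /set2P hb : b \in [set c; d] by rewrite -eq_set set22.
have /set2P hc : c \in [set a; b] by rewrite eq_set set21.
have /set2P hd : d \in [set a; b] by rewrite eq_set set22.
by case: ha; [left|right]; congr (_, _); intuition congruence.
Qed.

Lemma mem_edges n (G : sgraph n) i j : ([set i; j] \in edges G) = adj G i j.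
Proof.
apply/imsetP/idP => [[[a b]]|ij]; last by exists (i, j); rewrite ?inE.
by rewrite inE /= => ab /eq_set2[[-> ->]|[-> ->]] //; rewrite adj_sym.
Qed.

(** * The integer root against the real power *)

Lemma root_exists n k : 0 < k -> exists D, [/\ 0 < D, n <= D ^ k,
  forall d, 0 < d -> n <= d ^ k -> D <= d & 1 < D -> D.-1 ^ k < n].
Proof.
move=> k_gt0; have ex : exists d, (0 < d) && (n <= d ^ k).
  exists n.+1; rewrite /=; apply: leq_trans (leqnSn n) _.
  by rewrite -[X in X <= _]expn1 leq_pexp2l.
case: (ex_minnP ex) => D /andP[D_gt0 D_pow] D_min; exists D; split=> //.
  by move=> d d_gt0 d_pow; apply: D_min; rewrite d_gt0.
move=> D_gt1; rewrite ltnNge; apply/negP=> le_n.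
have /D_min : (0 < D.-1) && (n <= D.-1 ^ k) by rewrite le_n; lia.
by lia.
Qed.

Local Open Scope ring_scope.

(** For [D > 1], minimality gives [D - 1 <= n^(1/k)], and [1 <= n^(1/k)] since [n > 0]; adding the
    two yields the factor 2. *)
Lemma root_le (R : realType) (n k D : nat) : (0 < k)%N -> (0 < n)%N ->
  ((1 < D)%N -> (D.-1 ^ k < n)%N) -> D%:R <= 2 * n%:R `^ (k%:R)^-1 :> R.
Proof.
move=> k_gt0 n_gt0 D_prev; have k_neq0 : k%:R != 0 :> R by rewrite pnatr_eq0 -lt0n.
have root_ge1 : 1 <= n%:R `^ (k%:R)^-1 :> R.
  by rewrite -[leLHS](powRr0 n%:R); apply: ler_powR; rewrite ?ler1n // invr_ge0 ler0n.
have [D_gt1|D_le1] := ltnP 1 D; last first.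
  have : D%:R <= 1 :> R by rewrite -[1]/(1%:R) ler_nat.
  by lra.
have lt_n := D_prev D_gt1.
have : D.-1%:R <= n%:R `^ (k%:R)^-1 :> R.
  have -> : D.-1%:R = (D.-1%:R `^ k%:R) `^ (k%:R)^-1 :> R.
    by rewrite -powRrM divff // powRr1.
  rewrite ge0_ler_powR ?nnegrE ?invr_ge0 ?powR_ge0 ?ler0n //.
  by rewrite powR_mulrn ?ler0n // -natrX ler_nat ltnW.
have -> : D%:R = D.-1%:R + 1 :> R by rewrite natr1 prednK //; lia.
by lra.
Qed.

Theorem theorem9p2 (R : realType) (k : nat) (hk : (2 <= k)%N) :
  exists (p : prog) (C : R),
    forall (n : nat) (G : sgraph n) (s : seq ('I_n * 'I_n)),
      edge_list G s ->
      (forall l : nat, (2 <= l <= k)%N -> ~ has_cycle G (2 * l + 1)) ->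
      exists (t : nat) (s' : state),
        [/\ exec p (input s) t s',
            accepts s' <-> has_triangle G
          & (0 < n)%N ->
            t%:R <= C * (#|edges G|%:R + n%:R `^ (1 + 2 / k%:R))].
Proof.
(* [K] is the factor in [total_cost_le], and the 4 comes from squaring [D <= 2 * n^(1/k)]. *)
pose K := (11 * k * 2 ^ k + 20 * k + 1000)%N.
exists (find_triangle k), (K%:R * 4) => n G s s_edges no_odd.
have k_gt0 : (0 < k)%N by lia.
have [D [D_gt0 D_pow D_min D_prev]] := root_exists n k_gt0.
have size_s : size s = #|edges G|.
  by move/perm_size: s_edges; rewrite size_map -cardE.
have nth1 i : (i < size s)%N -> forall x0, nth 0%N [seq val x.1 | x <- s] i = (nth x0 s i).1.
  by move=> lt_i x0; rewrite (nth_map x0).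
have nth2 i : (i < size s)%N -> forall x0, nth 0%N [seq val x.2 | x <- s] i = (nth x0 s i).2.
  by move=> lt_i x0; rewrite (nth_map x0).
have [t [s' [Ex le_t acc]]] : tr (find_triangle k) (total_cost n (size s) k D) (input s)
    (fun _ s' => regs s' 0 != 0%N <-> exists x y z, triangle (nat_adj G) x y z).
  apply: find_triangle_ok => //.
  - exact: nat_adj_lt.
  - exact: nat_adj_sym.
  - exact: nat_adj_irr.
  - move=> l c hl sz un; apply/negP=> cyc.
    by apply: (no_odd l hl); rewrite -sz; apply: nat_cycle.
  - by case=> [|[|[|r]]].
  - by move=> [|[|a]] x.
  - move=> i lt_i /=; have x0 : 'I_n * 'I_n by case: (s) lt_i.
    rewrite !upd_same upd_other // upd_same (nth1 _ _ x0) // (nth2 _ _ x0) //.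
    rewrite nat_adj_val -mem_edges -mem_enum.
    rewrite -(perm_mem s_edges); apply/mapP; exists (nth x0 s i) => //.
    exact: mem_nth.
  - move=> x y /nat_adjP[i [j [-> -> ]]]; rewrite -mem_edges -mem_enum.
    rewrite -(perm_mem s_edges) => /mapP[e e_s eq_set].
    exists (index e s); first by rewrite index_mem.
    rewrite /= !upd_same upd_other // upd_same (nth1 _ _ e) ?index_mem //.
    rewrite (nth2 _ _ e) ?index_mem // nth_index //.
    by case/eq_set2: eq_set => -[-> ->]; [left|right].
exists t, s'; split=> //; first by rewrite nat_triangle.
move=> n_gt0.
(* For [D >= 2], combine [D <= 2 * D.-1] with [D.-1 ^ k < n]. *)
have le_pow : (D ^ k <= 2 ^ k * n)%N.
  have [D_gt1|D_le1] := ltnP 1 D; last first.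
    have -> : D = 1%N by lia.
    by rewrite exp1n muln_gt0 expn_gt0.
  apply: leq_trans (_ : (2 * D.-1) ^ k <= _)%N; first by rewrite leq_exp2r //; lia.
  by rewrite expnMn leq_mul2l (ltnW (D_prev D_gt1)) orbT.
have le_T : (t <= K * (size s + n * (D * D)))%N.
  exact: leq_trans le_t (total_cost_le _ n_gt0 k_gt0 D_gt0 le_pow).
rewrite -(ler_nat R) natrM size_s [X in _ <= _ * X]natrD in le_T.
apply: le_trans le_T _; rewrite -mulrA.
apply: ler_wpM2l; rewrite ?ler0n // mulrDr; apply: lerD.
  by have : 0 <= #|edges G|%:R :> R by []; lra.
have n_neq0 : n%:R != 0 :> R by rewrite pnatr_eq0 -lt0n.
have -> : n%:R `^ (1 + 2 / k%:R) = n%:R * (n%:R `^ (k%:R)^-1 * n%:R `^ (k%:R)^-1) :> R.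
  rewrite powRD ?n_neq0 ?implybT // powRr1 ?ler0n //; congr (_ * _).
  by rewrite -powRD ?n_neq0 ?implybT //; congr (_ `^ _); lra.
have le_D := @root_le R n k D k_gt0 n_gt0 D_prev.
rewrite !natrM [leRHS]mulrCA; apply: ler_wpM2l; rewrite ?ler0n //.
have := ler_pM (ler0n R D) (ler0n R D) le_D le_D.
by move/le_trans; apply; lra.
Qed.
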